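(* Let $\Gamma$ be an $n$-dimensional Bieberbach group of diagonal type with holonomy group isomorphic to $C_2^2$, and let $k=b_1(\Gamma)$. Then either $\Gamma$ is poly-$\mathbb{Z}$ or $\Gamma\cong Z(\Gamma)\oplus(\mathbb{Z}^{n-k-3}\rtimes\Delta_P)$ (for some semidirect product of $\mathbb{Z}^{n-k-3}$ by $\Delta_P$), where $Z(\Gamma)$ is the center of $\Gamma$.
   Context: An $n$-dimensional crystallographic group is a discrete cocompact subgroup $\Gamma$ of $\mathrm{Isom}(\mathbb{E}^n)=O(n)\ltimes\mathbb{R}^n$. Its lattice subgroup is $\Gamma\cap\mathbb{R}^n\cong\mathbb{Z}^n$; its holonomy group is the finite group $G=\Gamma/(\Gamma\cap\mathbb{R}^n)$, and the conjugation action of $G$ on the lattice subgroup is the (faithful) holonomy representation $G\to\mathrm{GL}_n(\mathbb{Z})$. A Bieberbach group is a torsion-free crystallographic group. A crystallographic group is of diagonal type if it is isomorphic to a crystallographic group whose holonomy representation is diagonal (equivalently, the lattice subgroup has a $\mathbb{Z}$-basis $e_1,\dots,e_n$ with $g\cdot e_i=\pm e_i$ for all $g\in G$ and all $i$). A group is poly-$\mathbb{Z}$ if it has a (finite) normal series whose factor groups are isomorphic to $\mathbb{Z}$. The first Betti number $b_1(\Gamma)$ is the torsion-free rank of $\Gamma/[\Gamma,\Gamma]$. The group $\Delta_P$ is the 3-dimensional Hantzsche-Wendt group $$\Delta_P=\langle x,y\mid x^{-1}y^2xy^2=y^{-1}x^2yx^2=1\rangle .$$ *)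

(* Defs.v *)
From HB Require Import structures.
From mathcomp Require Import all_boot all_order all_algebra.
From mathcomp Require Import generic_quotient.
From mathcomp Require Import all_classical all_reals all_analysis.

Set Implicit Arguments.
Unset Strict Implicit.
Unset Printing Implicit Defensive.

Import GRing.Theory.
Import numFieldNormedType.Exports.

Local Open Scope group_scope.

(** Possibly infinite groups are [groupType]s, and a subgroup of [G] is a
    [groupClosed G]. *)

Definition isomorphic (G H : groupType) : Prop :=
  exists f : {multiplicative G -> H}, bijective f.

Definition torsion_free (G : groupType) : Prop :=
  forall (x : G) (m : nat), (0 < m)%N -> x ^+ m = 1 -> x = 1.

Definition zexp (G : groupType) (x : G) (a : int) : G :=
  match a with Posz m => x ^+ m | Negz m => x ^- m.+1 end.

Definition subgroup_type (G : groupType) (S : groupClosed G) : Type :=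
  {x : G | x \in S}.

Section SubgroupType.
Variables (G : groupType) (S : groupClosed G).
HB.instance Definition _ := [isSub of subgroup_type S for @sval G (fun x => x \in S)].
HB.instance Definition _ := [Choice of subgroup_type S by <:].
Lemma subgroup_closed : group_closed (fun x => x \in S).
Proof. by split; [exact: gpred1|move=> x y; exact: gpredF]. Qed.
HB.instance Definition _ :=
  SubChoice_isSubGroup.Build G (fun x => x \in S) (subgroup_type S) subgroup_closed.
End SubgroupType.

Definition Subgroup (G : groupType) (S : {pred G})
    (S1 : 1 \in S) (SM : mulg_closed S) (SV : invg_closed S) : groupClosed G :=
  GroupClosed.Pack (GroupClosed.Class (isInvClosed.Build G S SV)
    (isMul1Closed.Build G S S1) (isMulClosed.Build G S SM)).

Record normalClosed (G : groupType) := NormalClosed {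
  normal_subgroup :> groupClosed G;
  gpredJl : forall x y : G, x \in normal_subgroup -> x ^ y \in normal_subgroup
}.

Section Cosets.
Local Open Scope quotient_scope.
Variables (G : groupType) (S : groupClosed G).

Definition same_lcoset : rel G := fun x y => x^-1 * y \in S.

Lemma same_lcoset_refl : reflexive same_lcoset.
Proof. by move=> x; rewrite /same_lcoset mulVg gpred1. Qed.

Lemma same_lcoset_sym : symmetric same_lcoset.
Proof. by move=> x y; rewrite /same_lcoset -gpredV invgM invgK. Qed.

Lemma same_lcoset_trans : transitive same_lcoset.
Proof.
move=> y x z xy yz; rewrite /same_lcoset.
by have := gpredM _ _ xy yz; rewrite -mulgA mulVKg.
Qed.

Canonical same_lcoset_equiv :=
  EquivRel same_lcoset same_lcoset_refl same_lcoset_sym same_lcoset_trans.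

Definition coset_space : Type := {eq_quot same_lcoset}.
HB.instance Definition _ := Choice.on coset_space.
HB.instance Definition _ := EqQuotient.on coset_space.

End Cosets.

Definition quotient_group (G : groupType) (N : normalClosed G) : Type :=
  coset_space N.

Section QuotientGroup.
Local Open Scope quotient_scope.
Variables (G : groupType) (N : normalClosed G).

HB.instance Definition _ := Choice.on (quotient_group N).
HB.instance Definition _ := EqQuotient.on (quotient_group N).

Local Notation Q := (quotient_group N).

Lemma eq_quotient_group (x y : G) : (x = y %[mod Q]) <-> (x^-1 * y \in N).
Proof. by split=> [/eqP|/(@eqmodP _ (same_lcoset_equiv N))//]; rewrite piE. Qed.

Lemma repr_quotient_group (x : G) : (repr (\pi_Q x))^-1 * x \in N.
Proof. by apply/eq_quotient_group; rewrite reprK. Qed.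

Definition quotient_mul (a b : Q) : Q := \pi_Q (repr a * repr b).
Definition quotient_inv (a : Q) : Q := \pi_Q (repr a)^-1.

Lemma quotient_mulE x y : quotient_mul (\pi_Q x) (\pi_Q y) = \pi_Q (x * y).
Proof.
apply/eq_quotient_group; set u := repr _; set v := repr _.
have -> : (u * v)^-1 * (x * y) = (u^-1 * x) ^ v * (v^-1 * y).
  by rewrite /conjg invgM !mulgA mulgK.
by rewrite gpredM ?gpredJl ?repr_quotient_group.
Qed.

Lemma quotient_invE x : quotient_inv (\pi_Q x) = \pi_Q x^-1.
Proof.
apply/eq_quotient_group; set u := repr _; rewrite invgK.
have -> : u * x^-1 = ((u^-1 * x)^-1) ^ u^-1.
  by rewrite /conjg invgK invgM invgK !mulgA mulgK.
by rewrite gpredJl// gpredV repr_quotient_group.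
Qed.

Lemma quotient_mulA : associative quotient_mul.
Proof.
move=> a b c; rewrite -[a]reprK -[b]reprK -[c]reprK.
rewrite (quotient_mulE (repr b)) (quotient_mulE (repr a) (repr b)).
by rewrite (quotient_mulE (repr a)) (quotient_mulE _ (repr c)) mulgA.
Qed.

Lemma quotient_mul1 : left_id (\pi_Q 1) quotient_mul.
Proof. by move=> a; rewrite -[a]reprK quotient_mulE mul1g. Qed.

Lemma quotient_mulr1 : right_id (\pi_Q 1) quotient_mul.
Proof. by move=> a; rewrite -[a]reprK quotient_mulE mulg1. Qed.

Lemma quotient_mulV : left_inverse (\pi_Q 1) quotient_inv quotient_mul.
Proof. by move=> a; rewrite -[a]reprK quotient_invE quotient_mulE mulVg. Qed.

Lemma quotient_mulrV : right_inverse (\pi_Q 1) quotient_inv quotient_mul.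
Proof. by move=> a; rewrite -[a]reprK quotient_invE quotient_mulE mulgV. Qed.

HB.instance Definition _ := isGroup.Build Q quotient_mulA quotient_mul1
  quotient_mulr1 quotient_mulV quotient_mulrV.

End QuotientGroup.


Section Center.
Variable G : groupType.

Definition center_pred : {pred G} := fun z => `[< forall x : G, commute z x >].

Lemma center1 : 1 \in center_pred.
Proof. by apply/asboolP => x; rewrite /commute mul1g mulg1. Qed.

Lemma centerM : mulg_closed center_pred.
Proof.
move=> x y /asboolP cx /asboolP cy; apply/asboolP => z.
by rewrite /commute -mulgA (cy z) mulgA (cx z) mulgA.
Qed.

Lemma centerV : invg_closed center_pred.
Proof.
move=> x /asboolP cx; apply/asboolP => z; rewrite /commute.
by apply: (mulgI x); rewrite mulVKg mulgA (cx z) mulgK.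
Qed.


Definition group_center : groupClosed G := Subgroup center1 centerM centerV.

End Center.

Section CommutatorSubgroup.
Variable G : groupType.

Definition commutator_pred : {pred G} :=
  fun z => `[< forall S : groupClosed G,
                 (forall x y : G, [~ x, y] \in S) -> z \in S >].
Local Notation C := commutator_pred.

Lemma commutator1 : 1 \in C.
Proof. by apply/asboolP => S _; exact: gpred1. Qed.

Lemma commutatorM : mulg_closed C.
Proof.
move=> x y /asboolP Cx /asboolP Cy; apply/asboolP => S SP.
by rewrite gpredM ?Cx ?Cy.
Qed.

Lemma commutatorV : invg_closed C.
Proof. by move=> x /asboolP Cx; apply/asboolP => S SP; rewrite gpredV Cx. Qed.

Lemma commutatorJ (x y : G) : x \in C -> x ^ y \in C.
Proof.
move=> /asboolP Cx; apply/asboolP => S SP.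
have -> : x ^ y = x * [~ x, y] by rewrite /commg mulVKg.
by rewrite gpredM ?Cx ?SP.
Qed.


Definition commutator_subgroup : normalClosed G :=
  @NormalClosed G (Subgroup commutator1 commutatorM commutatorV) commutatorJ.

End CommutatorSubgroup.

Definition abelianization (G : groupType) : groupType :=
  quotient_group (commutator_subgroup G).

(** The order of the factors is irrelevant: [A] is always abelian below. *)

Definition Z_independent (A : groupType) (k : nat) (v : 'I_k -> A) : Prop :=
  forall a : 'I_k -> int,
    \prod_(i < k) zexp (v i) (a i) = 1 -> forall i, a i = 0%R.

Definition Z_basis (A : groupType) (k : nat) (e : 'I_k -> A) : Prop :=
  forall x : A, exists! a : {ffun 'I_k -> int},
    x = \prod_(i < k) zexp (e i) (a i).

(** The largest size of a [Z]-linearly independent family. *)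
Definition torsion_free_rank (A : groupType) (k : nat) : Prop :=
  (exists v : 'I_k -> A, Z_independent v) /\
  (forall (m : nat) (v : 'I_m -> A), Z_independent v -> (m <= k)%N).

Definition first_betti_number (G : groupType) (k : nat) : Prop :=
  torsion_free_rank (abelianization G) k.

Definition Zpow (m : nat) : groupType := Algebra.to_multiplicative 'rV[int]_m.

Definition infinite_cyclic (G : groupType) : Prop :=
  isomorphic G (Algebra.to_multiplicative int).

(** Each term of the series is normal in the next one, not necessarily in [G].
    [N] is the subgroup [H i], seen inside the group [H i.+1]. *)
Definition poly_Z (G : groupType) : Prop :=
  exists (r : nat) (H : nat -> groupClosed G),
    [/\ H 0%N =i [pred x | x == 1],
        H r =i predT
      & forall i, (i < r)%N ->
          {subset H i <= H i.+1} /\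
          exists N : normalClosed (subgroup_type (H i.+1)),
            (forall x : subgroup_type (H i.+1), (x \in N) = (val x \in H i)) /\
            infinite_cyclic (quotient_group N)].

Record group_action (H N : groupType) := GroupAction {
  gact :> H -> N -> N;
  gactM : forall h, {morph gact h : x y / x * y};
  gact1 : forall x, gact 1 x = x;
  gactA : forall h k x, gact (h * k) x = gact h (gact k x)
}.

(** The law is [(x, h) * (y, k) = (x * phi h y, h * k)]. *)
Definition semidirect (H N : groupType) (phi : group_action H N) : Type :=
  (N * H)%type.

Section Semidirect.
Variables (H N : groupType) (phi : group_action H N).
Local Notation S := (semidirect phi).

HB.instance Definition _ := Choice.copy S (N * H)%type.

Definition sd_mul (a b : S) : S := (a.1 * phi a.2 b.1, a.2 * b.2).
Definition sd_one : S := (1, 1).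
Definition sd_inv (a : S) : S := (phi a.2^-1 a.1^-1, a.2^-1).

Lemma gact_1 h : phi h 1 = 1.
Proof. by apply: (mulgI (phi h 1)); rewrite -gactM !mulg1. Qed.

Lemma sd_mulA : associative sd_mul.
Proof. by move=> a b c; rewrite /sd_mul /= gactM gactA !mulgA. Qed.

Lemma sd_mul1 : left_id sd_one sd_mul.
Proof. by case=> x h; rewrite /sd_mul /= gact1 !mul1g. Qed.

Lemma sd_mulr1 : right_id sd_one sd_mul.
Proof. by case=> x h; rewrite /sd_mul /= gact_1 !mulg1. Qed.

Lemma sd_mulV : left_inverse sd_one sd_inv sd_mul.
Proof. by case=> x h; rewrite /sd_mul /= -gactM !mulVg gact_1. Qed.

Lemma sd_mulrV : right_inverse sd_one sd_inv sd_mul.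
Proof. by case=> x h; rewrite /sd_mul /= -gactA !mulgV gact1 mulgV. Qed.

HB.instance Definition _ :=
  isGroup.Build S sd_mulA sd_mul1 sd_mulr1 sd_mulV sd_mulrV.
End Semidirect.

(** A letter [(t, false)] stands for the generator [t], and [(t, true)] for its
    inverse. *)

Definition word (T : choiceType) : choiceType := seq (T * bool).

Definition inv_word (T : choiceType) (w : word T) : word T :=
  rev [seq (l.1, ~~ l.2) | l <- w].

Inductive word_eq (T : choiceType) (R : seq (word T)) : word T -> word T -> Prop :=
| word_eq_refl u : word_eq R u u
| word_eq_sym u v : word_eq R u v -> word_eq R v u
| word_eq_trans u v w : word_eq R u v -> word_eq R v w -> word_eq R u w
| word_eq_cat u u' v v' :
    word_eq R u u' -> word_eq R v v' -> word_eq R (u ++ v) (u' ++ v')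
| word_eq_cancel t b : word_eq R [:: (t, b); (t, ~~ b)] [::]
| word_eq_relator r : r \in R -> word_eq R r [::].

Section Presentation.
Local Open Scope quotient_scope.
Variables (T : choiceType) (R : seq (word T)).

Definition word_eqb : rel (word T) := fun u v => `[< word_eq R u v >].

Lemma word_eqb_refl : reflexive word_eqb.
Proof. by move=> u; apply/asboolP; exact: word_eq_refl. Qed.

Lemma word_eqb_sym : symmetric word_eqb.
Proof. by move=> u v; apply/asboolP/asboolP; exact: word_eq_sym. Qed.

Lemma word_eqb_trans : transitive word_eqb.
Proof.
by move=> v u w /asboolP uv /asboolP vw; apply/asboolP; exact: word_eq_trans uv vw.
Qed.

Canonical word_eqb_equiv :=
  EquivRel word_eqb word_eqb_refl word_eqb_sym word_eqb_trans.

Definition presented_group : Type := {eq_quot word_eqb}.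
HB.instance Definition _ := Choice.on presented_group.
HB.instance Definition _ := EqQuotient.on presented_group.

Local Notation P := presented_group.

Lemma eq_presented u v : (u = v %[mod P]) <-> word_eq R u v.
Proof.
split=> [/eqP|uv]; first by rewrite piE => /asboolP.
by apply/eqP; rewrite piE; apply/asboolP.
Qed.

Lemma repr_presented u : word_eq R (repr (\pi_P u)) u.
Proof. by apply/eq_presented; rewrite reprK. Qed.

Lemma inv_word_cat (u v : word T) : inv_word (u ++ v) = inv_word v ++ inv_word u.
Proof. by rewrite /inv_word map_cat rev_cat. Qed.

Lemma inv_wordK : involutive (@inv_word T).
Proof.
move=> u; rewrite /inv_word map_rev revK -map_comp -[RHS]map_id.
by apply: eq_map => -[t b]; rewrite /= negbK.
Qed.

Lemma word_eq_catV (u : word T) : word_eq R (u ++ inv_word u) [::].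
Proof.
elim: u => [|[t b] u IH]; first exact: word_eq_refl.
rewrite -cat1s inv_word_cat.
apply: (@word_eq_trans _ _ _ ([:: (t, b)] ++ inv_word [:: (t, b)])).
  rewrite -catA; apply: word_eq_cat; first exact: word_eq_refl.
  rewrite catA -[X in word_eq _ _ X]cat0s.
  by apply: word_eq_cat => //; exact: word_eq_refl.
exact: word_eq_cancel.
Qed.

Lemma word_eq_catVl (u : word T) : word_eq R (inv_word u ++ u) [::].
Proof. by rewrite -{2}[u]inv_wordK; exact: word_eq_catV. Qed.

Lemma word_eq_inv (u v : word T) :
  word_eq R u v -> word_eq R (inv_word u) (inv_word v).
Proof.
move=> uv; apply: (@word_eq_trans _ _ _ (inv_word u ++ (v ++ inv_word v))).
  rewrite -[X in word_eq _ X _]cats0; apply: word_eq_cat; first exact: word_eq_refl.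
  exact/word_eq_sym/word_eq_catV.
rewrite catA -[X in word_eq _ _ X]cat0s; apply: word_eq_cat; last exact: word_eq_refl.
apply: (word_eq_trans _ (word_eq_catVl u)).
by apply: word_eq_cat; [exact: word_eq_refl|exact: word_eq_sym].
Qed.

Definition presented_mul (a b : P) : P := \pi_P (repr a ++ repr b).
Definition presented_inv (a : P) : P := \pi_P (inv_word (repr a)).

Lemma presented_mulE (u v : word T) :
  presented_mul (\pi_P u) (\pi_P v) = \pi_P (u ++ v).
Proof. by apply/eq_presented/word_eq_cat; exact: repr_presented. Qed.

Lemma presented_invE (u : word T) : presented_inv (\pi_P u) = \pi_P (inv_word u).
Proof. by apply/eq_presented/word_eq_inv; exact: repr_presented. Qed.

Lemma presented_mulA : associative presented_mul.
Proof.
move=> a b c; rewrite -[a]reprK -[b]reprK -[c]reprK.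
rewrite (presented_mulE (repr b)) (presented_mulE (repr a) (repr b)).
by rewrite (presented_mulE (repr a)) (presented_mulE _ (repr c)) catA.
Qed.

Lemma presented_mul1 : left_id (\pi_P [::]) presented_mul.
Proof. by move=> a; rewrite -[a]reprK presented_mulE. Qed.

Lemma presented_mulr1 : right_id (\pi_P [::]) presented_mul.
Proof. by move=> a; rewrite -[a]reprK presented_mulE cats0. Qed.

Lemma presented_mulV : left_inverse (\pi_P [::]) presented_inv presented_mul.
Proof.
move=> a; rewrite -[a]reprK presented_invE presented_mulE.
exact/eq_presented/word_eq_catVl.
Qed.

Lemma presented_mulrV : right_inverse (\pi_P [::]) presented_inv presented_mul.
Proof.
move=> a; rewrite -[a]reprK presented_invE presented_mulE.
exact/eq_presented/word_eq_catV.
Qed.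

HB.instance Definition _ := isGroup.Build P presented_mulA presented_mul1
  presented_mulr1 presented_mulV presented_mulrV.
End Presentation.

(** The generators [x], [y] are [false], [true] respectively. *)
Definition Delta_P_relators : seq (word bool) :=
  let x := (false, false) in let x' := (false, true) in
  let y := (true, false) in let y' := (true, true) in
  [:: [:: x'; y; y; x; y; y]; [:: y'; x; x; y; x; x]].

Definition Delta_P : groupType := presented_group Delta_P_relators.

Section OrthogonalGroup.
Local Open Scope ring_scope.
Variables (R : realType) (n : nat).

Definition orthogonal_group : Type := {A : 'M[R]_n | A^T *m A == 1%:M}.

HB.instance Definition _ :=
  [isSub of orthogonal_group for @sval 'M[R]_n (fun A => A^T *m A == 1%:M)].
HB.instance Definition _ := [Choice of orthogonal_group by <:].

Lemma orthogonalP (A : orthogonal_group) : (val A)^T *m val A = 1%:M.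
Proof. by apply/eqP; exact: (valP A). Qed.

Lemma orthogonal_subproof_mul (A B : orthogonal_group) :
  (val A *m val B)^T *m (val A *m val B) == 1%:M.
Proof.
by rewrite trmx_mul mulmxA -(mulmxA (val B)^T) orthogonalP mulmx1 orthogonalP.
Qed.

Lemma orthogonal_subproof_one : (1%:M : 'M[R]_n)^T *m 1%:M == 1%:M.
Proof. by rewrite trmx1 mulmx1. Qed.

Lemma orthogonal_subproof_inv (A : orthogonal_group) :
  ((val A)^T)^T *m (val A)^T == 1%:M.
Proof. by rewrite trmxK (mulmx1C (orthogonalP A)). Qed.

Definition orthogonal_mul (A B : orthogonal_group) : orthogonal_group :=
  exist _ (val A *m val B) (orthogonal_subproof_mul A B).
Definition orthogonal_one : orthogonal_group :=
  exist _ 1%:M orthogonal_subproof_one.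
Definition orthogonal_inv (A : orthogonal_group) : orthogonal_group :=
  exist _ (val A)^T (orthogonal_subproof_inv A).

Lemma orthogonal_mulA : associative orthogonal_mul.
Proof. by move=> A B C; apply: val_inj; exact: mulmxA. Qed.

Lemma orthogonal_mul1 : left_id orthogonal_one orthogonal_mul.
Proof. by move=> A; apply: val_inj; exact: mul1mx. Qed.

Lemma orthogonal_mulr1 : right_id orthogonal_one orthogonal_mul.
Proof. by move=> A; apply: val_inj; exact: mulmx1. Qed.

Lemma orthogonal_mulV : left_inverse orthogonal_one orthogonal_inv orthogonal_mul.
Proof. by move=> A; apply: val_inj; exact: orthogonalP. Qed.

Lemma orthogonal_mulrV : right_inverse orthogonal_one orthogonal_inv orthogonal_mul.
Proof. by move=> A; apply: val_inj; exact/mulmx1C/orthogonalP. Qed.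

HB.instance Definition _ := isGroup.Build orthogonal_group orthogonal_mulA
  orthogonal_mul1 orthogonal_mulr1 orthogonal_mulV orthogonal_mulrV.

Definition orthogonal_act (A : orthogonal_group) (v : Algebra.to_multiplicative 'cV[R]_n) :
  Algebra.to_multiplicative 'cV[R]_n := val A *m (v : 'cV[R]_n).

Lemma orthogonal_actM A : {morph orthogonal_act A : v w / (v * w)%g}.
Proof. by move=> v w; exact: mulmxDr. Qed.

Lemma orthogonal_act1 v : orthogonal_act 1%g v = v.
Proof. exact: mul1mx. Qed.

Lemma orthogonal_actA A B v :
  orthogonal_act (A * B)%g v = orthogonal_act A (orthogonal_act B v).
Proof. by rewrite /orthogonal_act mulmxA. Qed.

Definition orthogonal_action :
    group_action orthogonal_group (Algebra.to_multiplicative 'cV[R]_n) :=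
  GroupAction orthogonal_actM orthogonal_act1 orthogonal_actA.

End OrthogonalGroup.

(** The pair [(v, A)] is the isometry [x |-> A x + v]. *)
Definition Isom (R : realType) (n : nat) : Type :=
  semidirect (orthogonal_action R n).

(** [Isom R n] is topologized as a subspace of ['cV_n * 'M_n]. *)
Definition isometry_coord (R : realType) (n : nat) (g : Isom R n) :
  'cV[R]_n * 'M[R]_n := (g.1, val g.2).

HB.instance Definition _ (R : realType) (n : nat) :=
  Group.on (Isom R n).
HB.instance Definition _ (R : realType) (n : nat) :=
  Topological.copy (Isom R n) (initial_topology (@isometry_coord R n)).

Section Crystallographic.
Variables (R : realType) (n : nat) (Gamma : groupClosed (Isom R n)).

Definition discrete_subgroup : Prop :=
  forall g : Isom R n, g \in Gamma -> isolated [set` Gamma] g.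

Definition cocompact_subgroup : Prop :=
  compact [set: quotient_topology (coset_space Gamma)].

Definition crystallographic : Prop := discrete_subgroup /\ cocompact_subgroup.

Definition bieberbach : Prop :=
  crystallographic /\ torsion_free (subgroup_type Gamma).

End Crystallographic.

Section Lattice.
Variables (R : realType) (n : nat) (Gamma : groupClosed (Isom R n)).
Local Notation G := (subgroup_type Gamma).

Definition translation_pred : {pred G} := fun g => (val g).2 == 1.

Lemma translation1 : 1 \in translation_pred.
Proof. exact: eqxx. Qed.

Lemma translationM : mulg_closed translation_pred.
Proof. by move=> x y /eqP x1 /eqP y1; apply/eqP; rewrite /= x1 y1 mulg1. Qed.

Lemma translationV : invg_closed translation_pred.
Proof. by move=> x /eqP x1; apply/eqP; rewrite /= x1 invg1. Qed.

Lemma translationJ (x y : G) : x \in translation_pred -> x ^ y \in translation_pred.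
Proof. by move=> /eqP x1; apply/eqP; rewrite /= x1 mul1g mulVg. Qed.

Definition lattice : normalClosed G :=
  @NormalClosed G (Subgroup translation1 translationM translationV) translationJ.

Definition holonomy : groupType := quotient_group lattice.

(** The action [t |-> g t g^-1] of the class of [g]; recall that [x ^ y] stands
    for [y^-1 x y]. *)
Lemma holonomy_rep_subproof (q : holonomy) (t : subgroup_type lattice) :
  val t ^ (repr (q : quotient_group lattice))^-1 \in lattice.
Proof. exact/gpredJl/(valP t). Qed.

Definition holonomy_rep (q : holonomy) (t : subgroup_type lattice) :
    subgroup_type lattice :=
  Sub (val t ^ (repr (q : quotient_group lattice))^-1) (holonomy_rep_subproof q t).

Lemma translation_commute (s t : G) : s \in lattice -> t \in lattice -> commute s t.
Proof.
case: s => -[v A] Gs; case: t => -[w B] Gt /eqP /= A1 /eqP /= B1; subst A B.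
apply: val_inj; congr pair => /=.
by rewrite !orthogonal_act1; exact: addrC.
Qed.

Lemma holonomy_repE (g : G) (t : subgroup_type lattice) :
  val (holonomy_rep ((\pi_(quotient_group lattice) g)%qT) t) = val t ^ g^-1.
Proof.
rewrite /=; set h := repr _.
have hg : g^-1 * h \in lattice.
  by rewrite -gpredV invgM invgK repr_quotient_group.
have := translation_commute hg (valP t); rewrite /commute => E.
rewrite /conjg !invgK; apply: (mulgI g^-1); apply: (mulIg h).
by rewrite !mulgA mulgVK E mulVg mul1g mulgA.
Qed.

Definition diagonal_holonomy : Prop :=
  exists e : 'I_n -> subgroup_type lattice,
    Z_basis e /\
    forall (q : holonomy) (i : 'I_n),
      holonomy_rep q (e i) = e i \/ holonomy_rep q (e i) = (e i)^-1.

End Lattice.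

Definition diagonal_type (R : realType) (n : nat)
    (Gamma : groupClosed (Isom R n)) : Prop :=
  exists (m : nat) (Gamma' : groupClosed (Isom R m)),
    [/\ crystallographic Gamma', diagonal_holonomy Gamma'
      & isomorphic (subgroup_type Gamma) (subgroup_type Gamma')].

(* Main.v *)
(** Let [G] be an extension of [C_2^2] by a free abelian group [L] with a basis [e]
    each of whose members is fixed or inverted by every element of [G].  It is studied
    through the integers [tau g i], the [i]-th coordinate of [g^2] in [L]: when [g]
    fixes [e_i], this is twice the translation part of [g] along [e_i].  If [G] is
    torsion-free, every [g] outside [L] has an odd [tau g i] for some [e_i] that it
    fixes.  If some central [e_i] has an odd [tau g i], then [tau _ i], a second such
    coordinate on its kernel, and finally the coordinates of [L] exhibit [G] as
    poly-[Z].  Otherwise the centre splits off: three noncentral directions carry the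
    half-translations, one for each nontrivial class of [G / L], and suitable lifts of
    two generators of [C_2^2] generate a copy of [Delta_P] complementing the span of
    the remaining basis vectors.

    Geometrically, a discrete lattice has [R]-independent generators, and the lattice
    of a cocompact group with finite holonomy spans; hence it is its own centralizer,
    so it corresponds to the lattice of the diagonal model under the isomorphism, and
    the two dimensions agree. *)

Require Import Defs.
From HB Require Import structures.
From mathcomp Require Import all_boot all_order all_algebra.
From mathcomp Require Import generic_quotient.
From mathcomp Require Import all_classical all_reals all_analysis.
From mathcomp Require Import zify ring lra.

Set Implicit Arguments.
Unset Strict Implicit.
Unset Printing Implicit Defensive.

Import Order.TTheory GRing.Theory Num.Theory.
Import numFieldNormedType.Exports.

Local Open Scope group_scope.

(** * Morphisms and isomorphisms of possibly infinite groups *)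

Section Morphisms.
Variables (G H : groupType) (f : G -> H).
Hypothesis fM : {morph f : x y / x * y}.

Lemma morph_1 : f 1 = 1.
Proof. by apply: (mulgI (f 1)); rewrite -fM !mulg1. Qed.

Lemma morph_V : {morph f : x / x^-1}.
Proof. by move=> x; apply: (mulgI (f x)); rewrite -fM !mulgV morph_1. Qed.

Lemma morph_inj : (forall x, f x = 1 -> x = 1) -> injective f.
Proof.
move=> f1 x y fxy; apply: divg1_eq; apply: f1.
by rewrite fM morph_V fxy mulgV.
Qed.

End Morphisms.

Lemma inj_surj_bijective (T U : Type) (f : T -> U) :
  injective f -> (forall y, exists x, f x = y) -> bijective f.
Proof.
by move=> f_inj /choice[g fg]; exists g => // x; apply: f_inj; rewrite fg.
Qed.

Lemma morph_isomorphic (G H : groupType) (f : G -> H) :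
  {morph f : x y / x * y} -> (forall x, f x = 1 -> x = 1) ->
  (forall y, exists x, f x = y) -> isomorphic G H.
Proof.
move=> fM f1 f_surj.
pose F := HB.pack_for {multiplicative G -> H} f (isMultiplicative.Build _ _ f fM).
by exists F; apply: inj_surj_bijective => //; apply: morph_inj.
Qed.

Lemma isomorphic_sym (G H : groupType) : isomorphic G H -> isomorphic H G.
Proof.
case=> f [g fK gK]; have gM := can2_gmulfM fK gK.
apply: (@morph_isomorphic _ _ g) => // [y gy|x].
  by rewrite -(gK y) gy (morph_1 (@gmulfM _ _ f)).
by exists (f x).
Qed.

(** * Integer powers and products of powers *)

Section Zexp.
Variable G : groupType.
Implicit Types (x y : G) (a b : int).

Lemma zexp0 x : zexp x 0%R = 1. Proof. by []. Qed.

Lemma zexp1 x : zexp x 1%R = x. Proof. by []. Qed.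

Lemma zexpS x a : zexp x (a + 1)%R = zexp x a * x.
Proof.
case: a => [m|[|m]].
- have -> : (Posz m + 1 = Posz m.+1)%R by lia.
  exact: expgSr.
- have -> : (Negz 0 + 1 = 0)%R by lia.
  by rewrite /= expg1 mulVg.
have -> : (Negz m.+1 + 1 = Negz m)%R by lia.
by rewrite /= [in RHS]expgS invgM mulgVK.
Qed.

Lemma zexpB1 x a : zexp x (a - 1)%R = zexp x a * x^-1.
Proof. by apply: (mulIg x); rewrite mulgVK -zexpS subrK. Qed.

Lemma zexpD x a b : zexp x (a + b)%R = zexp x a * zexp x b.
Proof.
elim/int_ind: b => [|b IH|b IH]; first by rewrite addr0 mulg1.
- have -> : (a + b.+1 = a + b + 1)%R by lia.
  by rewrite zexpS IH -mulgA -zexpS; congr (_ * zexp x _); lia.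
have -> : (a - b.+1%:Z = a - b%:Z - 1)%R by lia.
by rewrite zexpB1 IH -mulgA -zexpB1; congr (_ * zexp x _); lia.
Qed.

Lemma zexpN x a : zexp x (- a)%R = (zexp x a)^-1.
Proof. by apply: (mulgI (zexp x a)); rewrite -zexpD addrN mulgV. Qed.

Lemma zexp_commute x y a : commute x y -> commute (zexp x a) y.
Proof.
case: a => m /= xy; first exact/commute_sym/commuteX/commute_sym.
exact/commute_sym/commuteV/commuteX/commute_sym.
Qed.

(** Induction on the exponent in both directions; with [x' = x^-1] it produces the sign changes of
    the Hantzsche-Wendt action. *)
Lemma zexp_twist x x' y a : y * x = x' * y -> y * zexp x a = zexp x' a * y.
Proof.
move=> yx; elim/int_ind: a => [|a IH|a IH]; first by rewrite mul1g mulg1.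
  have -> : (a.+1%:Z = a%:Z + 1)%R by lia.
  by rewrite !zexpS mulgA IH -!mulgA yx.
have -> : (- a.+1%:Z = - a%:Z - 1)%R by lia.
rewrite !zexpB1 mulgA IH -!mulgA; congr (_ * _).
by apply: (mulgI x'); rewrite mulVKg mulgA -yx mulgK.
Qed.

Lemma zexpV x a : zexp x^-1 a = zexp x (- a)%R.
Proof.
elim/int_ind: a => [|a IH|a IH] //.
  have -> : (a.+1%:Z = a%:Z + 1)%R by lia.
  by rewrite zexpS IH -zexpB1; congr zexp; lia.
have -> : (- a.+1%:Z = - a%:Z - 1)%R by lia.
by rewrite zexpB1 IH invgK -zexpS; congr zexp; lia.
Qed.

Lemma prod_zexpD k (v : 'I_k -> G) (a b : 'I_k -> int) :
  (forall i j, commute (v i) (v j)) ->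
  \prod_(i < k) zexp (v i) (a i + b i)%R =
  (\prod_(i < k) zexp (v i) (a i)) * \prod_(i < k) zexp (v i) (b i).
Proof.
move=> vC; under eq_bigr do rewrite zexpD.
apply: prodgM_commute => i j _ _.
exact/zexp_commute/commute_sym/zexp_commute.
Qed.

Lemma zexp_additive (V : zmodType) (f : G -> V) k (v : 'I_k -> G) (a : 'I_k -> int) :
  (forall x y, f (x * y)%g = f x + f y)%R ->
  f (\prod_(i < k) zexp (v i) (a i)) = (\sum_(i < k) f (v i) *~ a i)%R.
Proof.
move=> fM; have f1 : f 1 = 0%R by apply: (addrI (f 1)); rewrite -fM mulg1 addr0.
rewrite (big_morph f fM f1); apply: eq_bigr => i _.
elim/int_ind: (a i) => [|c IH|c IH]; first by rewrite f1 mulr0z.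
  have -> : (c.+1%:Z = c%:Z + 1)%R by lia.
  by rewrite zexpS fM IH mulrzDr mulr1z.
have fV : (f (v i)^-1%g = - f (v i))%R.
  by apply: (addrI (f (v i))); rewrite -fM mulgV f1 addrN.
have -> : (- c.+1%:Z = - c%:Z - 1)%R by lia.
by rewrite zexpB1 fM IH fV mulrzBr mulr1z.
Qed.

Lemma zexp_hom (f : G -> int) k (v : 'I_k -> G) (a : 'I_k -> int) :
  (forall x y, f (x * y)%g = f x + f y)%R ->
  f (\prod_(i < k) zexp (v i) (a i)) = (\sum_(i < k) a i * f (v i))%R.
Proof.
by move/zexp_additive ->; apply: eq_bigr => i _; rewrite mulrzz mulrC.
Qed.

End Zexp.

(** * Poly-Z groups *)

Section PolyZ.
Variable G : groupType.
Implicit Types P Q : G -> Prop.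

Definition is_subgroup Q : Prop :=
  [/\ Q 1, forall x y, Q x -> Q y -> Q (x * y) & forall x, Q x -> Q x^-1].

Lemma subgroup_exists Q :
  is_subgroup Q -> exists S : groupClosed G, forall x, (x \in S) <-> Q x.
Proof.
case=> Q1 QM QV; pose S : {pred G} := fun x => `[< Q x >].
have S1 : 1 \in S by apply/asboolP.
have SM : mulg_closed S by move=> x y /asboolP Qx /asboolP Qy; apply/asboolP/QM.
have SV : invg_closed S by move=> x /asboolP Qx; apply/asboolP/QV.
by exists (Subgroup S1 SM SV) => x; split=> [/asboolP|Qx]//; apply/asboolP.
Qed.

(** Subgroups are predicates on one fixed [G], which avoids nested subgroup types. In an extension,
    [f] is a total function but additive only on [Q]. *)
Inductive poly_Z_pred : (G -> Prop) -> Prop :=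
| poly_Z_trivial P : (forall x, P x <-> x = 1) -> poly_Z_pred P
| poly_Z_extension P Q (f : G -> int) :
    poly_Z_pred P -> is_subgroup Q ->
    (forall x y, Q x -> Q y -> f (x * y)%g = f x + f y)%R ->
    (exists2 x, Q x & f x = 1%R) ->
    (forall x, P x <-> Q x /\ f x = 0%R) -> poly_Z_pred Q.

Lemma kernel_normal (S : groupClosed G) (f : G -> int) :
  {in S &, forall x y, f (x * y)%g = f x + f y}%R ->
  exists N : normalClosed (subgroup_type S),
    forall x : subgroup_type S, (x \in N) = (f (val x) == 0%R).
Proof.
move=> fM; pose K : {pred subgroup_type S} := fun x => f (val x) == 0%R.
have f1 : f 1 = 0%R by have := fM 1 1 gpred1 gpred1; rewrite mulg1; lia.
have fV x : x \in S -> f x^-1%g = (- f x)%R.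
  by move=> Sx; have := fM x x^-1 Sx; rewrite gpredV mulgV f1 => /(_ Sx); lia.
have K1 : 1 \in K by rewrite unfold_in; apply/eqP.
have KM : mulg_closed K.
  move=> x y /eqP fx /eqP fy; apply/eqP.
  by rewrite (fM (val x) (val y)) ?fx ?fy//; exact: valP.
have KV : invg_closed K.
  by move=> x /eqP fx; apply/eqP; rewrite (fV (val x)) ?fx//; exact: valP.
have KJ (x y : subgroup_type S) : x \in K -> x ^ y \in K.
  move=> /eqP fx; apply/eqP; have [Sx Sy] := (valP x, valP y).
  rewrite (fM (val y)^-1 (val x * val y)) ?gpredM ?gpredV//.
  by rewrite (fM (val x) (val y))// fx fV//; lia.
by exists (@NormalClosed _ (Subgroup K1 KM KV) KJ).
Qed.

Lemma infinite_cyclic_quotient (S : groupClosed G) (f : G -> int)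
    (N : normalClosed (subgroup_type S)) :
  {in S &, forall x y, f (x * y)%g = f x + f y}%R ->
  (forall x : subgroup_type S, (x \in N) = (f (val x) == 0%R)) ->
  (exists2 x, x \in S & f x = 1%R) -> infinite_cyclic (quotient_group N).
Proof.
move=> fM fN [x0 Sx0 fx0].
have f1 : f 1 = 0%R by have := fM 1 1 gpred1 gpred1; rewrite mulg1; lia.
have fV x : x \in S -> f x^-1%g = (- f x)%R.
  by move=> Sx; have := fM x x^-1 Sx; rewrite gpredV mulgV f1 => /(_ Sx); lia.
have f_eq (u v : subgroup_type S) : (u^-1 * v \in N) = (f (val u) == f (val v)).
  rewrite fN (fM (val u)^-1 (val v)) ?gpredV ?(valP u) ?(valP v)//.
  by rewrite fV ?(valP u)// -[RHS]subr_eq0 -oppr_eq0 opprD opprK.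
pose F (q : quotient_group N) := f (val (repr q)).
have Fpi u : F (\pi_(quotient_group N) u)%qT = f (val u).
  by apply/eqP; rewrite -f_eq repr_quotient_group.
apply: (@morph_isomorphic _ _ (F : _ -> Algebra.to_multiplicative int)).
- move=> p q; rewrite -[p]reprK -[q]reprK.
  have -> : ((\pi_(quotient_group N) (repr p))%qT * (\pi_(quotient_group N) (repr q))%qT
     = (\pi_(quotient_group N) (repr p * repr q))%qT :> quotient_group N).
    exact: quotient_mulE.
  by rewrite !Fpi; exact: (fM _ _ (valP (repr p)) (valP (repr q))).
- move=> q Fq; rewrite -[q]reprK; apply/eq_quotient_group.
  rewrite f_eq; apply/eqP; rewrite -/(F q) Fq; exact/esym.
move=> z; suff [x Sx fx] : exists2 x, x \in S & f x = z.
  by exists (\pi_(quotient_group N) (Sub x Sx))%qT; rewrite Fpi SubK.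
elim/int_ind: z => [|z [x Sx fx]|z [x Sx fx]]; first by exists 1; rewrite ?gpred1.
  by exists (x * x0); rewrite ?gpredM// fM// fx fx0; lia.
by exists (x * x0^-1); rewrite ?gpredM ?gpredV// fM ?gpredV// fV// fx fx0; lia.
Qed.

Lemma poly_Z_pred_series Q : poly_Z_pred Q ->
  exists (r : nat) (H : nat -> groupClosed G),
    [/\ H 0%N =i [pred x | x == 1], forall x, (x \in H r) <-> Q x
      & forall i, (i < r)%N ->
          {subset H i <= H i.+1} /\
          exists N : normalClosed (subgroup_type (H i.+1)),
            (forall x : subgroup_type (H i.+1), (x \in N) = (val x \in H i)) /\
            infinite_cyclic (quotient_group N)].
Proof.
elim=> {Q}[P P1|P Q f _ [r [H [H0 Hr HS]]] Qg fM [x0 Qx0 fx0] PQ].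
  have [|S SP] := @subgroup_exists P.
    split=> [|x y /P1-> /P1->|x /P1->]; apply/P1 => //; first by rewrite mulg1.
    exact: invg1.
  exists 0%N, (fun=> S); split=> // x; apply/idP/eqP => [/SP/P1//|x1].
  exact/SP/P1.
have [S SQ] := subgroup_exists Qg.
(* The old series is kept up to index [r], and [S] is put on top at [r.+1]. *)
exists r.+1, (fun i => if (i <= r)%N then H i else S); split=> [x|x|i].
- by rewrite leq0n H0.
- by rewrite ltnn; exact: SQ.
rewrite ltnS => ir; have [->|ne] := eqVneq i r; last first.
  by rewrite ir ltn_neqAle ne ir; apply: HS; rewrite ltn_neqAle ne.
rewrite leqnn ltnn.
have fMS : {in S &, forall x y, f (x * y)%g = f x + f y}%R.
  by move=> x y /SQ Qx /SQ Qy; exact: fM.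
split=> [x /Hr/PQ[/SQ]//|].
have [N fN] := kernel_normal fMS; exists N; split.
  move=> x; rewrite fN; apply/eqP/idP => [fx|/Hr/PQ[]//].
  by apply/Hr/PQ; split=> //; apply/SQ/valP.
by apply: (infinite_cyclic_quotient fMS fN); exists x0 => //; apply/SQ.
Qed.

Lemma poly_Z_predT : poly_Z_pred (fun=> True) -> poly_Z G.
Proof.
case/poly_Z_pred_series=> r [H [H0 Hr HS]]; exists r, H; split=> // x.
exact/Hr.
Qed.

End PolyZ.

(** * Presentations and the group Delta_P *)

Section PresentedHom.
Local Open Scope quotient_scope.
Variables (T : choiceType) (R : seq (word T)).

Definition letter_eval (G : groupType) (f : T -> G) (l : T * bool) : G :=
  if l.2 then (f l.1)^-1 else f l.1.

Definition word_eval (G : groupType) (f : T -> G) (w : word T) : G :=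
  \prod_(l <- w) letter_eval f l.

Lemma word_eval_eq (G : groupType) (f : T -> G) :
  {in R, forall r, word_eval f r = 1} ->
  forall u v, word_eq R u v -> word_eval f u = word_eval f v.
Proof.
move=> fR u v; elim=> // {u v}.
- by move=> u v w _ -> _.
- by move=> u u' v v' _ uu' _ vv'; rewrite /word_eval !big_cat /= -!/(word_eval _ _) uu' vv'.
- move=> t b; rewrite /word_eval !big_cons !big_nil mulg1 /letter_eval /=.
  by case: b => /=; rewrite ?mulVg ?mulgV.
by move=> r /fR ->; rewrite /word_eval big_nil.
Qed.

(** Von Dyck's principle: equivalent words have equal values once the relators evaluate to 1, so any
    representative word may be evaluated. *)
Lemma presented_hom_exists (G : groupType) (f : T -> G) :
  {in R, forall r, word_eval f r = 1} ->
  exists2 F : presented_group R -> G, {morph F : x y / x * y} &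
    forall w, F (\pi_(presented_group R) w) = word_eval f w.
Proof.
move=> fR; pose F (d : presented_group R) := word_eval f (repr d).
have Fpi w : F (\pi_(presented_group R) w) = word_eval f w.
  exact/(word_eval_eq fR)/repr_presented.
exists F => // a b; rewrite -[a]reprK -[b]reprK.
have -> : \pi_(presented_group R) (repr a) * \pi_(presented_group R) (repr b) =
    \pi_(presented_group R) (repr a ++ repr b).
  exact: presented_mulE.
by rewrite !Fpi /word_eval big_cat.
Qed.

Definition presented_gen (t : T) : presented_group R :=
  \pi_(presented_group R) [:: (t, false)].

Lemma word_eval_gen (w : word T) :
  word_eval presented_gen w = \pi_(presented_group R) w.
Proof.
elim: w => [|[t b] w IH]; rewrite /word_eval ?big_nil// big_cons -/(word_eval _ _) IH.
have -> : letter_eval presented_gen (t, b) = \pi_(presented_group R) [:: (t, b)].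
  by case: b; rewrite /letter_eval //=; exact: presented_invE.
exact: presented_mulE.
Qed.

End PresentedHom.

(** * Normal forms from the Hantzsche-Wendt relations *)

Section HantzscheWendt.
Variables (H : groupType) (x y X Y Z : H).
Hypotheses (XE : X = x * x) (YE : Y = y * y) (ZE : Z = x * y * (x * y)).
Hypotheses (relx : x^-1 * Y * x * Y = 1) (rely : y^-1 * X * y * X = 1).

Lemma HW_YxY : Y * x * Y = x.
Proof. by apply: (mulgI x^-1); rewrite mulVg -relx !mulgA. Qed.

Lemma HW_XyX : X * y * X = y.
Proof. by apply: (mulgI y^-1); rewrite mulVg -rely !mulgA. Qed.

Lemma HW_xY : x * Y = Y^-1 * x.
Proof. by apply: (mulgI Y); rewrite mulVKg mulgA HW_YxY. Qed.

Lemma HW_yX : y * X = X^-1 * y.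
Proof. by apply: (mulgI X); rewrite mulVKg mulgA HW_XyX. Qed.

Lemma HW_xX : x * X = X * x. Proof. by rewrite XE mulgA. Qed.

Lemma HW_yY : y * Y = Y * y. Proof. by rewrite YE mulgA. Qed.

Lemma HW_twistV (a b c : H) : a * b = c * a -> a * b^-1 = c^-1 * a.
Proof. by move=> ab; apply: (mulgI c); rewrite mulVKg mulgA -ab mulgK. Qed.

(** Conjugation by [x] inverts [Y], so conjugation by [X = x * x] inverts it twice. *)
Lemma HW_XY : commute X Y.
Proof.
rewrite /commute (_ : X * Y = x * (x * Y)); last by rewrite XE !mulgA.
rewrite HW_xY mulgA (HW_twistV HW_xY) invgK.
by rewrite XE !mulgA.
Qed.

Lemma HW_xyX : x * y * X = X^-1 * (x * y).
Proof. by rewrite -mulgA HW_yX !mulgA (HW_twistV HW_xX). Qed.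

Lemma HW_xyY : x * y * Y = Y^-1 * (x * y).
Proof. by rewrite -mulgA HW_yY !mulgA HW_xY. Qed.

Lemma HW_ZX : commute Z X.
Proof.
by rewrite /commute ZE -mulgA HW_xyX !mulgA -(mulgA _ x) (HW_twistV HW_xyX) invgK !mulgA.
Qed.

Lemma HW_ZY : commute Z Y.
Proof.
by rewrite /commute ZE -mulgA HW_xyY !mulgA -(mulgA _ x) (HW_twistV HW_xyY) invgK !mulgA.
Qed.

(** Equivalently [Z * x * Z = x]: written as a word in [x] and [y], the left side collapses once the
    squares are moved across by the twist rules for [X] and [Y]. *)
Lemma HW_xZ : x * Z = Z^-1 * x.
Proof.
apply: (mulgI Z); rewrite mulVKg.
have -> : Z * (x * Z) = x * y * x * (y * X) * y * x * y by rewrite ZE XE !mulgA.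
rewrite HW_yX.
have -> : x * y * x * (X^-1 * y) * y * x * y = x * y * (x * X^-1) * Y * x * y.
  by rewrite YE !mulgA.
rewrite (HW_twistV HW_xX).
have -> : x * y * (X^-1 * x) * Y * x * y = x * (y * X^-1) * (x * Y) * x * y.
  by rewrite !mulgA.
rewrite (HW_twistV HW_yX) invgK HW_xY.
have -> : x * (X * y) * (Y^-1 * x) * x * y = x * X * (y * Y^-1) * X * y.
  by rewrite XE !mulgA.
rewrite (HW_twistV HW_yY).
have -> : x * X * (Y^-1 * y) * X * y = x * X * Y^-1 * (y * X) * y by rewrite !mulgA.
rewrite HW_yX.
have -> : x * X * Y^-1 * (X^-1 * y) * y = x * X * (Y^-1 * X^-1) * Y.
  by rewrite YE !mulgA.
by rewrite -invgM HW_XY invgM !mulgA mulgK mulgVK.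
Qed.

(** Conjugating [Z] by [y] gives [(yx)^2], and both [x (yx)^2] and [x Z^-1] equal [Z x]. *)
Lemma HW_yZ : y * Z = Z^-1 * y.
Proof.
have yxyx : y * Z * y^-1 = y * x * (y * x) by rewrite ZE !mulgA mulgK.
apply: (mulIg y^-1); rewrite yxyx mulgK.
apply: (mulgI x); rewrite (HW_twistV HW_xZ) invgK ZE !mulgA //.
Qed.

(** In [Delta_P] these elements form the lattice subgroup, with the three commuting squares as its
    basis. *)
Definition HW_translation (p q r : int) : H := zexp X p * zexp Y q * zexp Z r.

Lemma HW_translationM p q r p' q' r' :
  HW_translation p q r * HW_translation p' q' r' =
  HW_translation (p + p') (q + q') (r + r').
Proof.
have zC (u v : H) a b : commute u v -> zexp u a * zexp v b = zexp v b * zexp u a.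
  by move=> uv; exact/zexp_commute/commute_sym/zexp_commute/commute_sym.
rewrite /HW_translation !zexpD !mulgA.
have ZX := zC _ _ r p' HW_ZX; have ZY := zC _ _ r q' HW_ZY.
have YX := zC _ _ q p' (commute_sym HW_XY).
rewrite -(mulgA _ (zexp Z r) (zexp X p')) ZX !mulgA.
rewrite -(mulgA _ (zexp Y q) (zexp X p')) YX !mulgA.
by rewrite -(mulgA _ (zexp Z r) (zexp Y q')) ZY !mulgA.
Qed.

Lemma HW_x_translation p q r :
  x * HW_translation p q r = HW_translation p (- q) (- r) * x.
Proof.
rewrite /HW_translation !mulgA (zexp_twist _ HW_xX) -(mulgA _ x (zexp Y q)).
rewrite (zexp_twist _ HW_xY) !mulgA -(mulgA _ x (zexp Z r)) (zexp_twist _ HW_xZ) !mulgA.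
by rewrite !zexpV.
Qed.

Lemma HW_y_translation p q r :
  y * HW_translation p q r = HW_translation (- p) q (- r) * y.
Proof.
rewrite /HW_translation !mulgA (zexp_twist _ HW_yX) -(mulgA _ y (zexp Y q)).
rewrite (zexp_twist _ HW_yY) !mulgA -(mulgA _ y (zexp Z r)) (zexp_twist _ HW_yZ) !mulgA.
by rewrite !zexpV.
Qed.

Lemma HW_translation0 : HW_translation 0 0 0 = 1.
Proof. by rewrite /HW_translation !zexp0 !mulg1. Qed.

Lemma HW_translationX : HW_translation 1 0 0 = X.
Proof. by rewrite /HW_translation !zexp0 !mulg1 zexp1. Qed.

Lemma HW_translationY : HW_translation 0 1 0 = Y.
Proof. by rewrite /HW_translation !zexp0 zexp1 !mulg1 mul1g. Qed.

(** Since [Z] is the square of [x * y], [Z^-1 * (x * y)] is [y^-1 * x^-1]; the rest is the twist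
    rule for [y] and [X]. This reorders the generators in normal forms. *)
Lemma HW_yx : y * x = HW_translation (-1) 1 (-1) * (x * y).
Proof.
rewrite /HW_translation zexp1 !zexpN !zexp1.
have ZV : Z^-1 * (x * y) = (x * y)^-1 by rewrite ZE invgM mulgVK.
rewrite -mulgA ZV invgM mulgA.
have -> : X^-1 * Y * y^-1 = y * X.
  by rewrite HW_yX YE mulgA mulgK.
by rewrite XE !mulgA mulgK.
Qed.

(** Uniqueness is not part of the predicate: the images under [psi] will separate the forms by their
    classes and coordinates. *)
Inductive HW_normal_form : H -> Prop :=
  HWNormalForm p q r w : w \in [:: 1; x; y; x * y] ->
    HW_normal_form (HW_translation p q r * w).

Lemma HW_normal_form_translation h p q r :
  HW_normal_form h -> HW_normal_form (h * HW_translation p q r).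
Proof.
case=> p' q' r' w ww.
suff [p1 [q1 [r1 E]]] : exists p1 q1 r1,
    w * HW_translation p q r = HW_translation p1 q1 r1 * w.
  by rewrite -mulgA E mulgA HW_translationM; exact: HWNormalForm.
move: ww; rewrite !inE => /or4P[] /eqP ->.
- by exists p, q, r; rewrite mul1g mulg1.
- by do 3!eexists; exact: HW_x_translation.
- by do 3!eexists; exact: HW_y_translation.
by do 3!eexists; rewrite -mulgA HW_y_translation mulgA HW_x_translation mulgA.
Qed.

Lemma HW_normal_form_x h : HW_normal_form h -> HW_normal_form (h * x).
Proof.
case=> p q r w; rewrite !inE => /or4P[] /eqP ->; rewrite -mulgA.
- by rewrite mul1g; apply: HWNormalForm; rewrite !inE eqxx orbT.
- rewrite -XE -HW_translationX HW_translationM -[_ _ _ _]mulg1.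
  by apply: HWNormalForm; rewrite !inE eqxx.
- by rewrite HW_yx mulgA HW_translationM; apply: HWNormalForm; rewrite !inE eqxx !orbT.
rewrite -(mulgA x) HW_yx (mulgA x (HW_translation _ _ _)) HW_x_translation.
rewrite -(mulgA _ x) (mulgA x) -XE -HW_translationX.
do 2!rewrite (mulgA (HW_translation _ _ _)) HW_translationM.
by apply: HWNormalForm; rewrite !inE eqxx !orbT.
Qed.

Lemma HW_normal_form_y h : HW_normal_form h -> HW_normal_form (h * y).
Proof.
case=> p q r w; rewrite !inE => /or4P[] /eqP ->; rewrite -mulgA.
- by rewrite mul1g; apply: HWNormalForm; rewrite !inE eqxx !orbT.
- by apply: HWNormalForm; rewrite !inE eqxx !orbT.
- rewrite -YE -HW_translationY HW_translationM -[_ _ _ _]mulg1.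
  by apply: HWNormalForm; rewrite !inE eqxx.
rewrite -(mulgA x) -YE -HW_translationY HW_x_translation.
rewrite (mulgA (HW_translation _ _ _)) HW_translationM.
by apply: HWNormalForm; rewrite !inE eqxx !orbT.
Qed.

Lemma HW_normal_form_letter h (l : bool * bool) : HW_normal_form h ->
  HW_normal_form (h * letter_eval (fun b : bool => if b then y else x) l).
Proof.
(* An inverse letter is a translation followed by a generator, because [x^-1 = X^-1 * x]. *)
have xV : x^-1 = HW_translation (-1) 0 0 * x.
  by rewrite /HW_translation !zexp0 !mulg1 zexpN zexp1 XE invgM mulgVK.
have yV : y^-1 = HW_translation 0 (-1) 0 * y.
  by rewrite /HW_translation !zexp0 !mulg1 mul1g zexpN zexp1 YE invgM mulgVK.
move=> hN; case: l => -[] [] /=; rewrite /letter_eval /=.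
- by rewrite yV mulgA; exact/HW_normal_form_y/HW_normal_form_translation.
- exact: HW_normal_form_y.
- by rewrite xV mulgA; exact/HW_normal_form_x/HW_normal_form_translation.
exact: HW_normal_form_x.
Qed.

Lemma HW_normal_form_word (w : word bool) :
  HW_normal_form (word_eval (fun b : bool => if b then y else x) w).
Proof.
elim/last_ind: w => [|w l IH]; rewrite /word_eval.
  rewrite big_nil -HW_translation0 -[_ _ _ _]mulg1.
  by apply: HWNormalForm; rewrite !inE eqxx.
by rewrite -cats1 big_cat big_seq1; exact: HW_normal_form_letter.
Qed.

End HantzscheWendt.

Definition Delta_x : Delta_P := presented_gen Delta_P_relators false.
Definition Delta_y : Delta_P := presented_gen Delta_P_relators true.

Lemma Delta_P_hom (H : groupType) (x y : H) :
  x^-1 * (y * y) * x * (y * y) = 1 -> y^-1 * (x * x) * y * (x * x) = 1 ->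
  exists F : Delta_P -> H,
    [/\ {morph F : a b / a * b}, F Delta_x = x & F Delta_y = y].
Proof.
move=> relx rely; pose f (b : bool) := if b then y else x.
have fR : {in Delta_P_relators, forall r, word_eval f r = 1}.
  move=> r; rewrite /Delta_P_relators !inE => /orP[] /eqP ->.
    by rewrite /word_eval !big_cons big_nil /letter_eval /= mulg1 -relx !mulgA.
  by rewrite /word_eval !big_cons big_nil /letter_eval /= mulg1 -rely !mulgA.
have [F FM Fpi] := presented_hom_exists fR.
by exists F; split=> //; rewrite /Delta_x /Delta_y Fpi /word_eval big_seq1.
Qed.

Lemma Delta_P_normal_form (d : Delta_P) : 
  HW_normal_form Delta_x Delta_y (Delta_x * Delta_x) (Delta_y * Delta_y)
    (Delta_x * Delta_y * (Delta_x * Delta_y)) d.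
Proof.
have E r : r \in Delta_P_relators ->
    word_eval (presented_gen Delta_P_relators) r = 1.
  by move=> rR; rewrite word_eval_gen; apply/eq_presented/word_eq_relator.
have relx : Delta_x^-1 * (Delta_y * Delta_y) * Delta_x * (Delta_y * Delta_y) = 1.
  rewrite -[RHS](E (nth [::] Delta_P_relators 0)) ?mem_nth//.
  by rewrite /word_eval !big_cons big_nil /letter_eval /= mulg1 !mulgA.
have rely : Delta_y^-1 * (Delta_x * Delta_x) * Delta_y * (Delta_x * Delta_x) = 1.
  rewrite -[RHS](E (nth [::] Delta_P_relators 1)) ?mem_nth//.
  by rewrite /word_eval !big_cons big_nil /letter_eval /= mulg1 !mulgA.
have := HW_normal_form_word erefl erefl erefl relx rely (repr d).
rewrite (_ : (fun b : bool => _) = presented_gen Delta_P_relators).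
  by rewrite word_eval_gen reprK.
by apply/funext => -[].
Qed.

(** * Extensions with diagonal holonomy *)

(** The lattice is the kernel of [kap]; [coord] identifies it with integer vectors and carries no
    meaning outside it. The signs record the conjugation action. *)
Record diagonal_extension (G : groupType) (n : nat) := DiagonalExtension {
  kap : G -> ('Z_2 * 'Z_2)%type;
  coord : G -> 'I_n -> int;
  vec : ('I_n -> int) -> G;
  sgn : G -> 'I_n -> int;
  kapM : {morph kap : x y / x * y};
  kap_surj : forall z, exists x, kap x = z;
  coordM : forall x y, kap x = 1 -> kap y = 1 ->
    forall i, coord (x * y) i = (coord x i + coord y i)%R;
  coord_inj : forall x y, kap x = 1 -> kap y = 1 ->
    (forall i, coord x i = coord y i) -> x = y;
  kap_vec : forall a, kap (vec a) = 1;
  coord_vec : forall a i, coord (vec a) i = a i;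
  sgnP : forall g i, sgn g i = 1%R \/ sgn g i = (-1)%R;
  coordJ : forall g x, kap x = 1 ->
    forall i, coord (g * x * g^-1) i = (sgn g i * coord x i)%R;
  sgn_faithful : forall g, (forall i, sgn g i = 1%R) -> kap g = 1
}.

Lemma klein_sqr (z : ('Z_2 * 'Z_2)%type) : z * z = 1.
Proof. by case: z => -[[|[|?]] ?] [[|[|?]] ?] //; apply/eqP. Qed.

Lemma klein_span (u v z : ('Z_2 * 'Z_2)%type) : u != 1 -> v != 1 -> u != v ->
  z \in [:: 1; u; v; u * v].
Proof.
case: u => -[[|[|?]] ?] [[|[|?]] ?] //; case: v => -[[|[|?]] ?] [[|[|?]] ?] //;
case: z => -[[|[|?]] ?] [[|[|?]] ?] //.
Qed.

Section DiagonalExtension.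
Variables (G : groupType) (n : nat) (D : diagonal_extension G n).
Local Notation kap := (kap D).
Local Notation coord := (coord D).
Local Notation vec := (vec D).
Local Notation sgn := (sgn D).
Implicit Types (g h x y t : G) (i : 'I_n).

Lemma kap1 : kap 1 = 1. Proof. exact/morph_1/kapM. Qed.

Lemma kapV x : kap x^-1 = (kap x)^-1. Proof. exact/morph_V/kapM. Qed.

Lemma kap_sqr g : kap (g * g) = 1. Proof. by rewrite kapM klein_sqr. Qed.

Lemma kap_conj g x : kap x = 1 -> kap (g * x * g^-1) = 1.
Proof. by move=> x1; rewrite !kapM x1 mulg1 kapV mulgV. Qed.

Lemma coord1 i : coord 1 i = 0%R.
Proof. by have := coordM kap1 kap1 i; rewrite mulg1; lia. Qed.

Lemma coordV x i : kap x = 1 -> coord x^-1 i = (- coord x i)%R.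
Proof.
move=> x1; have := @coordM _ _ D x x^-1 x1; rewrite kapV x1 invg1 => /(_ erefl i).
by rewrite mulgV coord1; lia.
Qed.

Lemma coord_zexp x a i : kap x = 1 ->
  coord (zexp x a) i = (a * coord x i)%R /\ kap (zexp x a) = 1.
Proof.
move=> x1; elim/int_ind: a => [|a [IH k]|a [IH k]].
- by rewrite mul0r coord1 kap1.
- have -> : (a.+1%:Z = a%:Z + 1)%R by lia.
  by rewrite zexpS coordM// kapM k x1 mulg1 IH mulrDl mul1r.
have -> : (- a.+1%:Z = - a%:Z - 1)%R by lia.
have xV1 : kap x^-1 = 1 by rewrite kapV x1 invg1.
by rewrite zexpB1 coordM// kapM k xV1 mulg1 IH coordV// mulrBl mul1r.
Qed.

Lemma lattice_commute x y : kap x = 1 -> kap y = 1 -> commute x y.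
Proof.
move=> x1 y1; apply: (@coord_inj _ _ D); rewrite ?kapM ?x1 ?y1 ?mulg1// => i.
by rewrite !coordM// addrC.
Qed.

(** Signs are read off by conjugating the lattice vector whose coordinates are all 1. *)
Lemma sgnM g h i : sgn (g * h) i = (sgn g i * sgn h i)%R.
Proof.
pose t := vec (fun=> 1%R); have t1 : kap t = 1 := kap_vec _ _.
have := @coordJ _ _ D (g * h) t t1 i.
have -> : g * h * t * (g * h)^-1 = g * (h * t * h^-1) * g^-1.
  by rewrite invgM !mulgA.
by rewrite coordJ ?kap_conj// coordJ// /t coord_vec !mulr1.
Qed.

Lemma sgn_lattice x i : kap x = 1 -> sgn x i = 1%R.
Proof.
move=> x1; pose t := vec (fun=> 1%R); have t1 : kap t = 1 := kap_vec _ _.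
have := @coordJ _ _ D x t t1 i.
by rewrite (lattice_commute x1 t1) mulgK /t coord_vec mulr1.
Qed.

Lemma kap_eqP g h : kap g = kap h -> kap (g^-1 * h) = 1.
Proof. by rewrite kapM kapV => ->; rewrite mulVg. Qed.

Lemma sgn_kap g h i : kap g = kap h -> sgn g i = sgn h i.
Proof.
by move/kap_eqP/(sgn_lattice i) => gh; rewrite -[h](mulVKg g) sgnM gh mulr1.
Qed.

Definition tau g i : int := coord (g * g) i.

(** Write [(g t)^2] as [(g t g^-1) g^2 t]. Along a fixed direction the change is even, so the parity
    of [tau] depends only on the class of [g]; along a reflected one nothing changes. *)
Lemma tauM_lattice g t i : kap t = 1 ->
  tau (g * t) i = (tau g i + (1 + sgn g i) * coord t i)%R.
Proof.
move=> t1; rewrite /tau.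
have -> : g * t * (g * t) = g * t * g^-1 * (g * g) * t by rewrite !mulgA mulgVK.
have k1 : kap (g * t * g^-1) = 1 by apply: kap_conj.
have k2 : kap (g * t * g^-1 * (g * g)) = 1 by rewrite kapM k1 kap_sqr mulg1.
by rewrite coordM// coordM ?kap_sqr// coordJ//; lia.
Qed.

Lemma tau_lattice t i : kap t = 1 -> tau t i = (2 * coord t i)%R.
Proof. by move=> t1; rewrite /tau coordM//; lia. Qed.

(** Conjugation by [g] fixes [g * g] but negates this coordinate. *)
Lemma tau_reflected g i : sgn g i = (-1)%R -> tau g i = 0%R.
Proof.
move=> gi; have := @coordJ _ _ D g (g * g) (kap_sqr g) i.
by rewrite mulgA mulgK gi -/(tau g i); lia.
Qed.

(** Here [h * c = g^-1 * h * g] is conjugate to [h] by an element fixing [e_i], so both have the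
    same [tau]; this forces the commutator [c] to vanish along [e_i]. Then
    [(g h)^2 = g^2 (h c h^-1) h^2] gives the sum. *)
Lemma tauM g h i : sgn g i = 1%R -> sgn h i = 1%R ->
  tau (g * h) i = (tau g i + tau h i)%R.
Proof.
move=> gi hi.
have gV : sgn g^-1 i = 1%R.
  by have := sgnM g g^-1 i; rewrite mulgV sgn_lattice ?kap1// gi; lia.
pose c := h^-1 * (g^-1 * h * g).
have c1 : kap c = 1.
  rewrite /c !kapM !kapV.
  by move: (kap g) (kap h) => [[[|[|?]] ?] [[|[|?]] ?]] [[[|[|?]] ?] [[|[|?]] ?]] //;
    apply/eqP.
have ci : coord c i = 0%R.
  have : tau (h * c) i = tau h i.
    rewrite /tau /c mulVKg.
    have -> : g^-1 * h * g * (g^-1 * h * g) = g^-1 * (h * h) * g^-1^-1.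
      by rewrite invgK !mulgA mulgK.
    by rewrite coordJ ?kap_sqr// gV mul1r.
  by rewrite tauM_lattice// hi; lia.
rewrite {1}/tau.
have -> : g * h * (g * h) = g * g * (h * c * h) by rewrite /c mulVKg !mulgA mulgK.
have -> : h * c * h = h * c * h^-1 * (h * h) by rewrite !mulgA mulgVK.
have k1 : kap (h * c * h^-1) = 1 by apply: kap_conj.
have k2 : kap (h * c * h^-1 * (h * h)) = 1 by rewrite kapM k1 kap_sqr mulg1.
rewrite coordM ?kap_sqr// -/(tau g i); congr (_ + _)%R.
by rewrite coordM ?kap_sqr// coordJ// ci mulr0 add0r.
Qed.

Lemma tauV g i : tau g^-1 i = (- tau g i)%R.
Proof. by rewrite /tau -invgM coordV ?kap_sqr. Qed.

Definition central_type i : Prop := forall g, sgn g i = 1%R.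

Lemma central_type_basis g h i : kap g != 1 -> kap h != 1 -> kap g != kap h ->
  sgn g i = 1%R -> sgn h i = 1%R -> central_type i.
Proof.
move=> g1 h1 gh gi hi x.
have := klein_span (kap x) g1 h1 gh; rewrite !inE -kapM => /or4P[] /eqP E.
- by rewrite sgn_lattice.
- by rewrite (sgn_kap _ E).
- by rewrite (sgn_kap _ E).
by rewrite (sgn_kap _ E) sgnM gi hi.
Qed.

Lemma noncentral_type i : ~ central_type i -> exists g, sgn g i = (-1)%R.
Proof. by move=> /existsNP[g gi]; exists g; case: (sgnP D g i). Qed.

Section TorsionFree.
Hypothesis Gtf : torsion_free G.

(** If all these values were even, halving them would give a lattice element [t] with
    [(g * t)^2 = 1]; torsion-freeness then gives [g * t = 1], placing [g] in the lattice. *)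
Lemma odd_translation g : kap g <> 1 ->
  exists2 i, sgn g i = 1%R & exists a : int, tau g i = (2 * a + 1)%R.
Proof.
move=> g1; apply: contrapT => noi; apply: g1.
have half i : {a : int | sgn g i = 1%R -> tau g i = (2 * a)%R}.
  apply: cid; case: (sgnP D g i) => [gi|->]; last by exists 0%R.
  have := divz_eq (tau g i) 2; set q := divz _ _ => E.
  exists q => _; have := @modz_ge0 (tau g i) 2 isT.
  have := @ltz_mod (tau g i) 2 isT; move: E; set r := modz _ _ => E r2 r0.
  suff : r <> 1%R by lia.
  by move=> r1; apply: noi; exists i => //; exists q; lia.
(* Along a fixed direction this subtracts [tau g i] from the square; along a reflected one [tau]
   already vanishes. *)
pose t := vec (fun i => if sgn g i == 1%R then (- sval (half i))%R else 0%R).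
have t1 : kap t = 1 := kap_vec _ _.
have gt1 : g * t * (g * t) = 1.
  apply: (@coord_inj _ _ D); rewrite ?kap_sqr ?kap1// => i.
  rewrite -/(tau _ _) coord1 tauM_lattice// coord_vec.
  case: (half i) => a /= aP; case: (sgnP D g i) => gi.
    by rewrite gi eqxx aP//; lia.
  by rewrite tau_reflected// gi.
have /eqP := Gtf (ltn0Sn 1) (gt1 : (g * t) ^+ 2 = 1).
by rewrite mulg_eq1 => /eqP ->; rewrite kapV t1 invg1.
Qed.

End TorsionFree.

End DiagonalExtension.

(** * The poly-Z case: a central direction with an odd square coordinate *)

Section CentralHalfTranslation.
Variables (G : groupType) (n : nat) (D : diagonal_extension G n).
Hypothesis Gtf : torsion_free G.
Local Notation kap := (kap D).
Local Notation coord := (coord D).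
Local Notation vec := (vec D).
Local Notation sgn := (sgn D).
Local Notation tau := (tau D).

Definition supported (X : {set 'I_n}) (x : G) : Prop :=
  kap x = 1 /\ forall i, i \notin X -> coord x i = 0%R.

Lemma supported_subgroup X : is_subgroup (supported X).
Proof.
split=> [|x y [x1 xX] [y1 yX]|x [x1 xX]].
- by split=> [|i _]; rewrite ?kap1 ?coord1.
- split=> [|i iX]; first by rewrite kapM x1 y1 mulg1.
  by rewrite coordM// xX// yX.
by split=> [|i iX]; rewrite ?kapV ?x1 ?invg1// coordV// xX.
Qed.

(** One basis vector is removed at a time: its coordinate maps the subgroup onto the integers, with
    kernel supported on the rest. *)
Lemma poly_Z_supported X : poly_Z_pred (supported X).
Proof.
elim: {X}#|X| {-2}X (erefl #|X|) => [|m IH] X.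
  move/eqP; rewrite cards_eq0 => /eqP ->; apply: poly_Z_trivial => x; split.
    case=> x1 x0; apply: (@coord_inj _ _ D); rewrite ?kap1// => i.
    by rewrite coord1 x0// inE.
  by move=> ->; split=> [|i _]; rewrite ?kap1 ?coord1.
move=> Xm; have /card_gt0P[j jX] : (0 < #|X|)%N by rewrite Xm.
apply: (@poly_Z_extension _ (supported (X :\ j)) _ (fun x => coord x j)).
- by apply: IH; have := cardsD1 j X; rewrite jX Xm => -[].
- exact: supported_subgroup.
- by move=> x y [x1 _] [y1 _]; rewrite coordM.
- exists (vec (fun i => (i == j)%:R%R)); last by rewrite coord_vec eqxx.
  split=> [|i iX]; rewrite ?kap_vec// coord_vec.
  by case: eqP iX => // ->; rewrite jX.
move=> x; split=> [[x1 xX]|[[x1 xX] xj]].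
  split; last by rewrite xX// !inE eqxx.
  by split=> // i iX; rewrite xX// !inE (negbTE iX) andbF.
by split=> // i; rewrite !inE negb_and negbK => /orP[/eqP->|/xX].
Qed.

Variables (i : 'I_n) (g : G) (a : int).
Hypothesis iZ : central_type D i.
Hypothesis gi : tau g i = (2 * a + 1)%R.

Lemma tau_kap_parity x y j : kap x = kap y -> sgn x j = 1%R ->
  exists b : int, tau y j = (tau x j + 2 * b)%R.
Proof.
move=> /kap_eqP xy xj; exists (coord (x^-1 * y) j).
by rewrite -[in LHS](mulVKg x y) tauM_lattice// xj.
Qed.

(** Multiplying by a multiple of [e_j] shifts [tau] by an even amount, which normalizes odd values
    to 1 and even ones to 0. *)
Lemma tau_adjust x j (b : int) : sgn x j = 1%R ->
  exists y, [/\ kap y = kap x, tau y j = (tau x j + 2 * b)%R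
    & forall l, l != j -> tau y l = tau x l].
Proof.
move=> xj; pose t := vec (fun l => if l == j then b else 0%R).
have t1 : kap t = 1 := kap_vec _ _.
exists (x * t); split=> [||l lj]; first by rewrite kapM t1 mulg1.
  by rewrite tauM_lattice// xj coord_vec eqxx.
by rewrite tauM_lattice// coord_vec (negbTE lj) mulr0 addr0.
Qed.

Lemma kap_odd_neq1 : kap g != 1.
Proof. by apply/eqP => g1; move: gi; rewrite tau_lattice//; lia. Qed.

(** Along a central direction the parity of [tau] is a homomorphism from [C_2^2], so its kernel
    contains a nontrivial class; an even shift then reaches 0. *)
Lemma even_element_exists : exists2 c, kap c != 1 & tau c i = 0%R.
Proof.
suff [c c1 [b cb]] : exists2 c, kap c != 1 & exists b : int, tau c i = (2 * b)%R.
  have [d [dc di _]] := tau_adjust (- b) (iZ c).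
  by exists d; rewrite ?dc// di cb; lia.
have [z z1 zg] : exists2 z : ('Z_2 * 'Z_2)%type, z != 1 & z != kap g.
  have := kap_odd_neq1; move: (kap g) => [[[|[|?]] ?] [[|[|?]] ?]] //= _.
  - by exists (1%R, 0%R).
  - by exists (0%R, 1%R).
  by exists (0%R, 1%R).
have [h hz] := kap_surj D z.
have [b hb] : exists b : int, tau h i = (2 * b)%R \/ tau h i = (2 * b + 1)%R.
  by exists (divz (tau h i) 2); have := divz_eq (tau h i) 2;
    have := @modz_ge0 (tau h i) 2 isT; have := @ltz_mod (tau h i) 2 isT; lia.
case: hb => hb; first by exists h; [rewrite hz|exists b].
(* If [h] is odd then [h * g] is even, and it lies outside the lattice because the classes of [h]
   and [g] differ. *)
exists (h * g); last by exists (a + b + 1)%R; rewrite tauM// hb gi; lia.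
rewrite kapM hz; apply: contra zg => /eqP zg1; apply/eqP.
by rewrite -[z]mulg1 -(klein_sqr (kap g)) mulgA zg1 mul1g.
Qed.

Lemma poly_Z_central : poly_Z G.
Proof.
have [c c1 ci] := even_element_exists.
have [j cj [b cb]] := odd_translation Gtf (elimN eqP c1).
have ij : j != i by apply/eqP => ji; move: ci; rewrite -ji cb; lia.
pose K x := tau x i = 0%R.
(* Both [g] and [c * g] are odd along [i], so [K] meets only the lattice and the class of [c]. These
   fix [e_j], hence [tau _ j] is additive on [K]. *)
have Kkap x : K x -> kap x = 1 \/ kap x = kap c.
  move=> Kx; have cg : kap c != kap g.
    apply/eqP => cg; have [e] := tau_kap_parity cg (iZ c).
    by rewrite ci gi; lia.
  have := klein_span (kap x) c1 kap_odd_neq1 cg.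
  rewrite !inE -kapM => /or4P[] /eqP E; [by left|by right| |].
    have [e] := tau_kap_parity E (iZ x).
    by rewrite Kx gi; lia.
  have [e] := tau_kap_parity E (iZ x).
  by rewrite Kx tauM// ci gi; lia.
have Ksgn x : K x -> sgn x j = 1%R.
  by case/Kkap => [/(sgn_lattice j)//|/(sgn_kap j) ->].
have Kg : is_subgroup K.
  split=> [|x y Kx Ky|x Kx]; rewrite /K.
  - by rewrite tau_lattice ?kap1// coord1 mulr0.
  - by rewrite tauM// Kx Ky.
  by rewrite tauV// Kx.
have PK : poly_Z_pred K.
  apply: (@poly_Z_extension _ (supported (~: [set i; j])) _ (fun x => tau x j)) => //.
  - exact: poly_Z_supported.
  - by move=> x y /Ksgn xj /Ksgn yj; rewrite tauM.
  - have [d [_ dj di]] := tau_adjust (- b) cj.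
    by exists d; rewrite ?dj ?cb /K ?di 1?eq_sym//; lia.
  move=> x; split=> [[x1 xX]|[Kx xj]].
    by split; rewrite /K tau_lattice// xX ?mulr0// !inE negbK eqxx ?orbT.
  (* As [tau c j] is odd, no element of the class of [c] has value 0. *)
  have x1 : kap x = 1.
    case/Kkap: Kx => // xc; have [e] := tau_kap_parity (esym xc) cj.
    by rewrite xj cb; lia.
  split=> // l; rewrite !inE negbK => /orP[] /eqP ->.
    by move: Kx; rewrite /K tau_lattice//; lia.
  by move: xj; rewrite tau_lattice//; lia.
apply: poly_Z_predT; apply: (@poly_Z_extension _ K _ (fun x => tau x i)) => //.
- by move=> x y _ _; rewrite tauM.
- have [d [_ di _]] := tau_adjust (- a) (iZ g).
  by exists d => //; rewrite di gi; lia.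
by move=> x; split=> [|[]].
Qed.

End CentralHalfTranslation.

(** * The first Betti number *)

(** More rows than columns give a nonzero rational vector in the left kernel, whose denominators are
    then cleared. *)
Lemma integer_relation (m k : nat) (M : 'I_m -> 'I_k -> int) : (k < m)%N ->
  exists a : 'I_m -> int, (exists j, a j <> 0%R) /\
    forall i, (\sum_(j < m) a j * M j i = 0)%R.
Proof.
move=> km; pose A : 'M[rat]_(m, k) := (\matrix_(j, i) (M j i)%:~R)%R.
have : (kermx A != 0)%R.
  by rewrite -mxrank_eq0 mxrank_ker subn_eq0 -ltnNge (leq_ltn_trans (rank_leq_col A)).
case/rowV0Pn=> u /sub_kermxP uA u0.
(* The vector is packed as the coefficients of a polynomial so that [rat_poly_scale] supplies a
   common denominator [d]. *)
have [q [d d0 E]] := rat_poly_scale (\poly_(j < m) (if insub j is Some l then u 0 l else 0))%R.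
have uq (j : 'I_m) : (u 0 j = d%:~R^-1 * (q`_j)%:~R)%R.
  have := congr1 (fun p : {poly rat} => p`_j)%R E.
  by rewrite coefZ coef_map/= coef_poly ltn_ord valK.
exists (fun j => q`_j)%R; split.
  have [j uj] : exists j, (u 0 j != 0)%R.
    apply: contrapT => u'; case/eqP: u0; apply/rowP => j; rewrite mxE.
    by apply/eqP; apply: contrapT => /negP uj; apply: u'; exists j.
  by exists j => qj; move: uj; rewrite uq qj mulr0 eqxx.
move=> i; apply/eqP; rewrite -(intr_eq0 rat); apply/eqP.
have := congr1 (fun B : 'rV_k => B 0 i)%R uA; rewrite !mxE => uAi.
rewrite -[RHS](mulr0 (d%:~R : rat)%R) -uAi mulr_sumr rmorph_sum/=.
apply: eq_bigr => j _; rewrite uq !mxE rmorphM/=.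
by rewrite !mulrA mulfV ?mul1r// intr_eq0.
Qed.

Section Betti.
Local Open Scope quotient_scope.
Variables (G : groupType) (n : nat) (D : diagonal_extension G n).
Local Notation kap := (kap D).
Local Notation coord := (coord D).
Local Notation vec := (vec D).
Local Notation sgn := (sgn D).
Local Notation tau := (tau D).
Local Notation Gab := (abelianization G).
Local Notation ab := (\pi_(quotient_group (commutator_subgroup G)) : G -> Gab).

Definition central_types : {set 'I_n} := [set i | `[< central_type D i >]].

Lemma abM : {morph ab : x y / x * y}.
Proof. by move=> x y; apply/esym; exact: quotient_mulE. Qed.

Lemma ab_surj (q : Gab) : exists x, ab x = q.
Proof. by exists (repr (q : quotient_group (commutator_subgroup G))); rewrite reprK. Qed.

Lemma ab_commute (p q : Gab) : commute p q.
Proof.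
have [x <-] := ab_surj p; have [y <-] := ab_surj q.
rewrite /commute -!abM; apply/eq_quotient_group/asboolP => S SP.
by have := SP y x; congr (_ \in S); rewrite /commg /conjg invgM !mulgA.
Qed.

Lemma ab_conj x y : ab (y * x * y^-1) = ab x.
Proof. by rewrite !abM (morph_V abM) (ab_commute (ab y)) mulgK. Qed.

Lemma central_tau_commutator i x :
  central_type D i -> x \in commutator_subgroup G -> tau x i = 0%R.
Proof.
move=> iZ /asboolP xC; have tV g : tau g^-1 i = (- tau g i)%R by rewrite tauV.
pose K : {pred G} := fun g => tau g i == 0%R.
have K1 : 1 \in K by apply/eqP; rewrite tau_lattice ?kap1// coord1.
have KM : mulg_closed K by move=> g h /eqP gK /eqP hK; apply/eqP; rewrite tauM// gK hK.
have KV : invg_closed K by move=> g /eqP gK; apply/eqP; rewrite tV gK.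
apply/eqP/(xC (Subgroup K1 KM KV)) => g h; apply/eqP.
by rewrite /commg /conjg !tauM// !tV; lia.
Qed.

Lemma central_tau_factor i : central_type D i ->
  exists2 f : Gab -> int, forall p q, (f (p * q)%g = f p + f q)%R &
    forall x, f (ab x) = tau x i.
Proof.
move=> iZ; pose f (q : Gab) := tau (repr (q : quotient_group (commutator_subgroup G))) i.
have fab x : f (ab x) = tau x i.
  have := central_tau_commutator iZ (repr_quotient_group (commutator_subgroup G) x).
  by rewrite tauM// tauV// -/(f (ab x)); lia.
exists f => // p q; have [x <-] := ab_surj p; have [y <-] := ab_surj q.
by rewrite -abM !fab tauM.
Qed.

(** In the abelianization [t] equals each of its conjugates, and the product of
    the conjugates of [t] under [G / L] has coordinates
    [(1 + sgn g) (1 + sgn h) coord t]. *)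
Lemma ab_torsion t : kap t = 1 -> (forall i, central_type D i -> coord t i = 0%R) ->
  ab t * ab t * (ab t * ab t) = 1.
Proof.
move=> t1 t0.
have [g gk] := kap_surj D (1%R, 0%R); have [h hk] := kap_surj D (0%R, 1%R).
pose s := t * (g * t * g^-1) * ((h * t * h^-1) * (g * h * t * (g * h)^-1)).
suff s1 : s = 1.
  by rewrite -(morph_1 abM) -s1 /s abM (abM t) (abM (h * t * h^-1)) !ab_conj.
have kc x : kap (x * t * x^-1) = 1 by apply: kap_conj.
have k1 : kap (t * (g * t * g^-1)) = 1 by rewrite kapM t1 kc mulg1.
have k2 : kap (h * t * h^-1 * (g * h * t * (g * h)^-1)) = 1.
  by rewrite kapM !kc mulg1.
have sk : kap s = 1 by rewrite /s (kapM _ (t * _)) k1 k2 mulg1.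
apply: (@coord_inj _ _ D); rewrite ?kap1// => i.
rewrite coordM// coordM// [X in (_ + X)%R]coordM// !coordJ// sgnM coord1.
have [iZ|iNZ] := pselect (central_type D i); first by rewrite t0// !mulr0.
case: (sgnP D g i) => gi; case: (sgnP D h i) => hi; rewrite gi hi; try lia.
by case: iNZ; apply: (@central_type_basis _ _ D g h) => //; rewrite ?gk ?hk.
Qed.

(** The maps [tau _ i] separate the classes of the central basis vectors. Conversely, any larger
    family has a nontrivial integer combination killed by all these maps, which is torsion by
    [ab_torsion]. *)
Lemma betti_central_types : torsion_free_rank Gab #|central_types|.
Proof.
have TZ (j : 'I_#|central_types|) : central_type D (enum_val j).
  by have := enum_valP j; rewrite inE => /asboolP.
split.
  exists (fun j => ab (vec (fun i => (i == enum_val j)%:R%R))) => a a1 l.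
  have [f fM fE] := central_tau_factor (TZ l).
  have := zexp_hom (fun j => ab (vec (fun i => (i == enum_val j)%:R%R))) a fM.
  rewrite a1 -(morph_1 abM) fE tau_lattice ?kap1// coord1.
  rewrite (bigD1 l)//= big1 => [|j jl]; rewrite fE tau_lattice ?kap_vec// coord_vec.
    by rewrite eqxx; lia.
  by rewrite (inj_eq enum_val_inj) eq_sym (negbTE jl) !mulr0.
move=> m v v_indep; rewrite leqNgt; apply/negP => km.
have /choice[f fP] (j : 'I_#|central_types|) : exists f : Gab -> int,
    (forall p q, f (p * q)%g = f p + f q)%R /\
    forall x, f (ab x) = tau x (enum_val j).
  by have [f fM fE] := central_tau_factor (TZ j); exists f.
have [a [[j aj] aM]] := integer_relation (fun j i => f i (v j)) km.
pose w := \prod_(j < m) zexp (v j) (a j).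
have fw i : f i w = 0%R by rewrite (zexp_hom v a (fP i).1) aM.
have [x xw] := ab_surj w.
(* The exponent 8 is 2 times 4: the square of the lift [x] lies in the lattice, where [ab_torsion]
   kills fourth powers. *)
have w8 : w * w * (w * w) * (w * w * (w * w)) = 1.
  have := @ab_torsion (x * x) (kap_sqr D x); rewrite !abM xw; apply => i iZ.
  have iT : i \in central_types by rewrite inE; apply/asboolP.
  have := fw (enum_rank_in iT i); rewrite -xw (fP _).2 enum_rankK_in//.
have vC i l : commute (v i) (v l) by apply: ab_commute.
case: aj; move: w8; rewrite /w -!prod_zexpD// => /v_indep/(_ j); lia.
Qed.

End Betti.

(** * The Hantzsche-Wendt splitting *)

Section HantzscheWendtSplitting.
Variables (G : groupType) (n : nat) (D : diagonal_extension G n).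
Hypothesis Gtf : torsion_free G.
Hypothesis central_even :
  forall i, central_type D i -> forall g, exists a : int, tau D g i = (2 * a)%R.
Local Notation kap := (kap D).
Local Notation coord := (coord D).
Local Notation vec := (vec D).
Local Notation sgn := (sgn D).
Local Notation tau := (tau D).

Lemma sgnV g i : sgn g^-1 i = sgn g i.
Proof.
have := sgnM D g g^-1 i; rewrite mulgV sgn_lattice ?kap1//.
by case: (sgnP D g i) => ->; case: (sgnP D g^-1 i) => ->.
Qed.

(** If the direction given by [odd_translation] were also fixed by a second nontrivial class, it
    would be central, where all values are even. *)
Lemma odd_type_exists g : kap g != 1 ->
  exists i, [/\ sgn g i = 1%R, exists a : int, tau g i = (2 * a + 1)%R
    & forall h, kap h != 1 -> kap g != kap h -> sgn h i = (-1)%R].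
Proof.
move=> g1; have [i gi [a ga]] := odd_translation Gtf (elimN eqP g1).
exists i; split=> //; first by exists a.
move=> h h1 gh; case: (sgnP D h i) => // hi.
have iZ := central_type_basis g1 h1 gh gi hi.
by have [b] := central_even iZ g; lia.
Qed.

Lemma normalized_element g i (a : int) : sgn g i = 1%R -> ~ central_type D i ->
  tau g i = (2 * a + 1)%R ->
  exists x, [/\ kap x = kap g, tau x i = 1%R
    & forall l, central_type D l -> tau x l = 0%R].
Proof.
move=> gi iNZ ga.
have /choice[b bP] l : exists b : int, (l = i -> tau g l + 2 * b = 1)%R /\
    (central_type D l -> tau g l + 2 * b = 0)%R.
  have [lZ|lNZ] := pselect (central_type D l); last first.
    (* Among noncentral directions only [i] is constrained; [- a] is used for all of them. *)
    by exists (- a)%R; split=> // ->; rewrite ga; lia.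
  have [c gc] := central_even lZ g; exists (- c)%R; split=> [li|_]; last by lia.
  by case: iNZ; rewrite -li.
exists (g * vec b); split=> [||l lZ].
- by rewrite kapM kap_vec mulg1.
- by rewrite tauM_lattice ?kap_vec// coord_vec gi; have [/(_ erefl)] := bP i; lia.
by rewrite tauM_lattice ?kap_vec// coord_vec lZ; have [_ /(_ lZ)] := bP l; lia.
Qed.

(** Each of [A], [B], [C] is fixed by a single nontrivial class, that of [x], [y], [x * y]
    respectively, whose square has coordinate 1 there. The vanishing along central directions yields
    the relators of [Delta_P]. *)
Record HW_generators (x y : G) (A B C : 'I_n) : Prop := HWGenerators {
  HW_kx : kap x = (1%R, 0%R); HW_ky : kap y = (0%R, 1%R);
  HW_xT : forall l, central_type D l -> tau x l = 0%R;
  HW_yT : forall l, central_type D l -> tau y l = 0%R;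
  HW_xA : sgn x A = 1%R; HW_yA : sgn y A = (-1)%R; HW_tA : tau x A = 1%R;
  HW_xB : sgn x B = (-1)%R; HW_yB : sgn y B = 1%R; HW_tB : tau y B = 1%R;
  HW_xC : sgn x C = (-1)%R; HW_yC : sgn y C = (-1)%R; HW_tC : tau (x * y) C = 1%R
}.

Lemma HW_generators_exist : exists x y A B C, HW_generators x y A B C.
Proof.
have [g gk] := kap_surj D (1%R, 0%R); have [h hk] := kap_surj D (0%R, 1%R).
have ghk : kap (g * h) = (1%R, 1%R) by rewrite kapM gk hk; apply/eqP.
have [A [gA [a gAa] Ah]] : exists i, [/\ sgn g i = 1%R,
    exists a : int, tau g i = (2 * a + 1)%R & sgn h i = (-1)%R].
  have [|i [gi ga ih]] := @odd_type_exists g; first by rewrite gk.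
  by exists i; split=> //; apply: ih; rewrite ?gk ?hk.
have [B [hB [b hBb] Bg]] : exists i, [/\ sgn h i = 1%R,
    exists a : int, tau h i = (2 * a + 1)%R & sgn g i = (-1)%R].
  have [|i [gi ga ih]] := @odd_type_exists h; first by rewrite hk.
  by exists i; split=> //; apply: ih; rewrite ?gk ?hk.
have [C [gC hC oddC]] : exists i, [/\ sgn g i = (-1)%R, sgn h i = (-1)%R &
    exists a : int, tau (g * h) i = (2 * a + 1)%R].
  have [|i [gi ga ih]] := @odd_type_exists (g * h); first by rewrite ghk.
  by exists i; split=> //; apply: ih; rewrite ?ghk ?gk ?hk.
have [|x0 [x0k x0A x0T]] := normalized_element gA _ gAa.
  by move=> /(_ h); rewrite Ah.
have [|y [yk yB yT]] := normalized_element hB _ hBb.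
  by move=> /(_ g); rewrite Bg.
have sx0 i : sgn x0 i = sgn g i by exact: sgn_kap.
have sy i : sgn y i = sgn h i by exact: sgn_kap.
have [c x0yC] : exists c : int, tau (x0 * y) C = (2 * c + 1)%R.
  have [e ghe] := oddC.
  have ghx : kap (g * h) = kap (x0 * y) by rewrite !kapM x0k yk.
  have sgh : sgn (g * h) C = 1%R by rewrite sgnM gC hC.
  have [f ->] := tau_kap_parity ghx sgh.
  by exists (e + f)%R; rewrite ghe; lia.
(* Since [y] reflects [C], moving [t] across [y] turns [c] into [- c], and the square of
   [x0 * t * y] gets [C]-coordinate [2c + 1 - 2c = 1]. Away from [C], [tau x0] is unchanged. *)
pose t := vec (fun i => if i == C then c else 0%R).
have t1 : kap t = 1 := kap_vec _ _.
have neAC : A != C by apply/eqP => neAC; move: gC; rewrite -neAC gA.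
have neBC : B != C by apply/eqP => neBC; move: hC; rewrite -neBC hB.
have tx i : i != C -> tau (x0 * t) i = tau x0 i.
  by move=> iC; rewrite tauM_lattice// coord_vec (negbTE iC) mulr0 addr0.
have tC l : central_type D l -> l != C.
  by move=> lZ; apply/eqP => lC; move: gC; rewrite -lC lZ.
exists (x0 * t), y, A, B, C; split.
- by rewrite kapM t1 mulg1 x0k.
- by rewrite yk.
- by move=> l lZ; rewrite tx ?tC// x0T.
- exact: yT.
- by rewrite sgnM (sgn_lattice _ t1) mulr1 sx0.
- by rewrite sy.
- by rewrite tx.
- by rewrite sgnM (sgn_lattice _ t1) mulr1 sx0.
- by rewrite sy.
- by [].
- by rewrite sgnM (sgn_lattice _ t1) mulr1 sx0.
- by rewrite sy.
have -> : x0 * t * y = x0 * y * (y^-1 * t * y^-1^-1) by rewrite invgK !mulgA mulgK.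
rewrite tauM_lattice ?kap_conj// coordJ// sgnV sgnM sx0 sy gC hC coord_vec eqxx.
by rewrite x0yC; lia.
Qed.

Variables (x y : G) (A B C : 'I_n).
Hypothesis gen : HW_generators x y A B C.

(** The coordinates are [(1 + sgn g i) * tau h i]. They vanish if [g] or [h] reflects [e_i]; if both
    fix it, the direction is central and [hT] applies. *)
Lemma HW_relation g h : (forall l, central_type D l -> tau h l = 0%R) ->
  kap g != 1 -> kap h != 1 -> kap g != kap h ->
  g^-1 * (h * h) * g * (h * h) = 1.
Proof.
move=> hT g1 h1 gh.
have E : g^-1 * (h * h) * g = g^-1 * (h * h) * g^-1^-1 by rewrite invgK.
have k1 : kap (g^-1 * (h * h) * g) = 1 by rewrite E kap_conj ?kap_sqr.
have k2 : kap (g^-1 * (h * h) * g * (h * h)) = 1 by rewrite kapM k1 kap_sqr mulg1.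
apply: (@coord_inj _ _ D); rewrite ?kap1// => i.
rewrite coordM ?kap_sqr// E coordJ ?kap_sqr// sgnV coord1 -/(tau h i).
case: (sgnP D g i) => gi; rewrite gi; last by lia.
case: (sgnP D h i) => hi; last by rewrite tau_reflected//; lia.
by rewrite hT//; exact: (central_type_basis g1 h1 gh).
Qed.

Lemma HW_hom_exists : exists F : Delta_P -> G,
  [/\ {morph F : a b / a * b}, F Delta_x = x & F Delta_y = y].
Proof.
by apply: Delta_P_hom; apply: HW_relation;
  rewrite ?(HW_kx gen) ?(HW_ky gen)//; [exact: (HW_yT gen)|exact: (HW_xT gen)].
Qed.

Variable psi : Delta_P -> G.
Hypothesis psiM : {morph psi : a b / a * b}.
Hypothesis psix : psi Delta_x = x.
Hypothesis psiy : psi Delta_y = y.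

Definition Delta_translation : int -> int -> int -> Delta_P :=
  HW_translation (Delta_x * Delta_x) (Delta_y * Delta_y)
    (Delta_x * Delta_y * (Delta_x * Delta_y)).

Lemma psi_zexp d a : psi (zexp d a) = zexp (psi d) a.
Proof.
elim/int_ind: a => [|a IH|a IH]; first exact: morph_1.
  have -> : (a.+1%:Z = a%:Z + 1)%R by lia.
  by rewrite !zexpS psiM IH.
have -> : (- a.+1%:Z = - a%:Z - 1)%R by lia.
by rewrite !zexpB1 psiM IH morph_V.
Qed.

(** Among [x], [y], [x * y], each has a square with coordinate 1 along its own direction and 0 along
    the other two, which it reflects. *)
Lemma psi_translation p q r : let t := psi (Delta_translation p q r) in
  [/\ kap t = 1, coord t A = p, coord t B = q & coord t C = r].
Proof.
have -> : psi (Delta_translation p q r) =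
    zexp (x * x) p * zexp (y * y) q * zexp (x * y * (x * y)) r.
  by rewrite /Delta_translation /HW_translation !psiM !psi_zexp !psiM psix psiy.
move=> t; have kz g a : kap (zexp (g * g) a) = 1.
  by have [] := coord_zexp a A (kap_sqr D g).
have k1 : kap (zexp (x * x) p * zexp (y * y) q) = 1 by rewrite kapM !kz mulg1.
have tE i : coord t i = (p * tau x i + q * tau y i + r * tau (x * y) i)%R.
  have cz g a : coord (zexp (g * g) a) i = (a * tau g i)%R.
    by have [] := coord_zexp a i (kap_sqr D g).
  by rewrite /t coordM// coordM// !cz.
split; first by rewrite /t kapM k1 kz mulg1.
- rewrite tE (HW_tA gen) (tau_reflected (HW_yA gen)) tau_reflected; first by lia.
  by rewrite sgnM (HW_xA gen) (HW_yA gen).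
- rewrite tE (HW_tB gen) (tau_reflected (HW_xB gen)) tau_reflected; first by lia.
  by rewrite sgnM (HW_xB gen) (HW_yB gen).
by rewrite tE (HW_tC gen) (tau_reflected (HW_xC gen)) (tau_reflected (HW_yC gen)); lia.
Qed.

(** The representatives [x], [y], [x * y] map to nontrivial classes, so only 1 can occur in the
    normal form of [d]. *)
Lemma psi_lattice d : kap (psi d) = 1 -> exists p q r, d = Delta_translation p q r.
Proof.
case: (Delta_P_normal_form d) => p q r w; rewrite -/Delta_translation.
have [k1 _ _ _] := psi_translation p q r.
rewrite psiM kapM k1 mul1g => ww w1; exists p, q, r.
move: ww w1; rewrite !inE => /or4P[] /eqP ->; rewrite ?mulg1// ?psiM ?kapM ?psix ?psiy.
- by rewrite (HW_kx gen).
- by rewrite (HW_ky gen).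
by rewrite (HW_kx gen) (HW_ky gen).
Qed.

Lemma psi_lattice_surj g : exists d, kap (psi d) = kap g.
Proof.
have := klein_span (kap g) (_ : kap x != 1) (_ : kap y != 1) (_ : kap x != kap y).
rewrite (HW_kx gen) (HW_ky gen) => /(_ isT isT isT).
rewrite !inE => /or4P[] /eqP ->.
- by exists 1; rewrite (morph_1 psiM) kap1.
- by exists Delta_x; rewrite psix (HW_kx gen).
- by exists Delta_y; rewrite psiy (HW_ky gen).
by exists (Delta_x * Delta_y); rewrite psiM psix psiy kapM (HW_kx gen) (HW_ky gen).
Qed.

(** A central [z] has only signs [+1], so faithfulness puts it in the lattice; along a noncentral
    direction some [g] negates its coordinate while commuting with it. *)
Lemma center_lattice z :
  z \in group_center G <->
  kap z = 1 /\ forall i, ~ central_type D i -> coord z i = 0%R.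
Proof.
split=> [/asboolP zC|[z1 z0]].
  have z1 : kap z = 1.
    apply: (@sgn_faithful _ _ D) => i.
    have := @coordJ _ _ D z (vec (fun=> 1%R)) (kap_vec _ _) i.
    by rewrite zC mulgK coord_vec mulr1.
  split=> // i iNZ; have [g gi] := noncentral_type iNZ.
  by have := @coordJ _ _ D g z z1 i; rewrite -zC mulgK gi; lia.
apply/asboolP => g; apply: (mulIg g^-1); rewrite mulgK.
apply: (@coord_inj _ _ D); rewrite ?kap_conj// => i.
rewrite coordJ//; have [->|/z0->] := pselect (central_type D i); last by rewrite mulr0.
by rewrite mul1r.
Qed.

Definition noncyclic_types : {set 'I_n} :=
  ~: (central_types D :|: [set A; B; C]).

(** The signs of [x] and [y] show that [A], [B], [C] are distinct and noncentral. *)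
Lemma central_types_size : (#|central_types D| + 3 <= n)%N /\
  #|noncyclic_types| = (n - #|central_types D| - 3)%N.
Proof.
have neAB : A != B.
  by apply/eqP => neAB; have := HW_xA gen; rewrite neAB (HW_xB gen).
have neAC : A != C.
  by apply/eqP => neAC; have := HW_xA gen; rewrite neAC (HW_xC gen).
have neBC : B != C.
  by apply/eqP => neBC; have := HW_yB gen; rewrite neBC (HW_yC gen).
have c3 : #|[set A; B; C]| = 3%N.
  by rewrite finset.setUC cardsU1 cards2 !inE neAB (eq_sym C A)
    (eq_sym C B) (negbTE neAC) (negbTE neBC).
have dis : #|central_types D :|: [set A; B; C]| = (#|central_types D| + 3)%N.
  rewrite cardsU c3 (_ : _ :&: _ = finset.set0) ?cards0 ?subn0//; apply/setP => i.
  rewrite !inE; apply/negP => /andP[/asboolP iZ].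
  rewrite -orbA => /or3P[] /eqP iE; move: iZ; rewrite iE.
  - by move=> /(_ y); rewrite (HW_yA gen).
  - by move=> /(_ x); rewrite (HW_xB gen).
  by move=> /(_ y); rewrite (HW_yC gen).
have := cardsC (central_types D :|: [set A; B; C]); rewrite dis card_ord.
by rewrite -/noncyclic_types; lia.
Qed.

(** The isomorphism multiplies a central element, a vector supported on [noncyclic_types] and an
    element of the image of [psi]. On the lattice it is triangular: [A], [B], [C] determine the last
    factor, the other noncentral directions the vector, the central ones the first. *)
Lemma center_semidirect_splitting (m : nat) (mE : #|noncyclic_types| = m) :
  exists phi : group_action Delta_P (Zpow m),
    isomorphic G (subgroup_type (group_center G) * semidirect phi)%type.
Proof.
pose iota (j : 'I_m) : 'I_n := enum_val (cast_ord (esym mE) j).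
have iota_inj : injective iota by move=> j l /enum_val_inj/cast_ord_inj.
have iotaN j : iota j \in noncyclic_types by exact: enum_valP.
have iota_surj i : i \in noncyclic_types -> exists j, i = iota j.
  move=> iN; exists (cast_ord mE (enum_rank_in iN i)).
  by rewrite /iota cast_ordK enum_rankK_in.
pose act (d : Delta_P) (v : Zpow m) : Zpow m :=
  (\row_j (sgn (psi d) (iota j) * (v : 'rV[int]_m) 0 j))%R.
have actM d : {morph act d : u v / u * v}.
  by move=> u v; apply/rowP => j; rewrite !mxE mulrDr.
have act1 v : act 1 v = v.
  apply/rowP => j; rewrite !mxE (morph_1 psiM).
  by rewrite sgn_lattice ?kap1// mul1r.
have actA d e v : act (d * e) v = act d (act e v).
  by apply/rowP => j; rewrite !mxE psiM sgnM mulrA.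
pose phi := GroupAction actM act1 actA; exists phi; apply: isomorphic_sym.
(* As [iota] is injective, the sum has one term on [noncyclic_types] and none elsewhere. *)
pose mu (v : Zpow m) : G :=
  vec (fun i => \sum_(j | iota j == i) (v : 'rV[int]_m) 0 j)%R.
have mu1 v : kap (mu v) = 1 by exact: kap_vec.
have mu_iota v j : coord (mu v) (iota j) = (v : 'rV[int]_m) 0%R j.
  by rewrite coord_vec (big_pred1 j) // => l; rewrite (inj_eq iota_inj).
have mu0 v i : i \notin noncyclic_types -> coord (mu v) i = 0%R.
  rewrite coord_vec => iN; rewrite big1// => j /eqP ij.
  by move: iN; rewrite -ij iotaN.
have muM v w : mu (v * w) = mu v * mu w.
  apply: (@coord_inj _ _ D); rewrite ?kapM ?mu1 ?mulg1// => i.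
  by rewrite coordM// !coord_vec -big_split; apply: eq_bigr => j _; rewrite mxE.
have mu_act d v : psi d * mu v * (psi d)^-1 = mu (act d v).
  apply: (@coord_inj _ _ D); rewrite ?kap_conj// => i; rewrite coordJ//.
  have [/iota_surj[j ->]|iN] := boolP (i \in noncyclic_types).
    by rewrite !mu_iota mxE.
  by rewrite !mu0// mulr0.
pose F (a : subgroup_type (group_center G) * semidirect phi) : G :=
  val a.1 * mu a.2.1 * psi a.2.2.
have zT (z : subgroup_type (group_center G)) : kap (val z) = 1 /\
    forall i, ~ central_type D i -> coord (val z) i = 0%R.
  by apply/center_lattice/valP.
have zC (z : subgroup_type (group_center G)) g : commute (val z) g.
  have zz : val z \in group_center G := valP z.
  by move/asboolP: zz; apply.
have NZ i : i \in noncyclic_types \/ i \in [set A; B; C] -> ~ central_type D i.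
  move=> iN iZ; have iT : i \in central_types D by rewrite inE; apply/asboolP.
  case: iN; first by rewrite !inE asboolT.
  rewrite !inE -orbA => /or3P[] /eqP iE; move: iZ; rewrite iE.
  - by move=> /(_ y); rewrite (HW_yA gen).
  - by move=> /(_ x); rewrite (HW_xB gen).
  by move=> /(_ y); rewrite (HW_yC gen).
have inA : A \in [set A; B; C] by rewrite !inE eqxx.
have inB : B \in [set A; B; C] by rewrite !inE eqxx !orbT.
have inC : C \in [set A; B; C] by rewrite !inE eqxx !orbT.
have notN i : i \in [set A; B; C] -> i \notin noncyclic_types.
  by move=> iABC; rewrite inE negbK inE iABC orbT.
apply: (@morph_isomorphic _ _ F).
- move=> [z [v d]] [z' [v' d']].
  rewrite -[LHS]/(val z * val z' * mu (v * act d v') * psi (d * d')).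
  rewrite -[RHS]/(val z * mu v * psi d * (val z' * mu v' * psi d')).
  rewrite muM -mu_act psiM !mulgA !mulgVK.
  congr (_ * _ * _); rewrite -!mulgA; congr (_ * _).
  by rewrite (zC z') !mulgA.
- move=> [z [v d]]; rewrite /F /= => zvd.
  have k1 : kap (val z * mu v) = 1 by rewrite kapM mu1 (zT z).1 mulg1.
  have d1 : kap (psi d) = 1.
    by have := congr1 kap zvd; rewrite kapM k1 mul1g kap1.
  have [p [q [r dE]]] := psi_lattice d1.
  have cE i : (coord (val z) i + coord (mu v) i + coord (psi d) i = 0)%R.
    by rewrite -!coordM// ?zvd ?coord1// (zT z).1.
  have dABC i : i \in [set A; B; C] -> coord (psi d) i = 0%R.
    move=> iABC; have := cE i; rewrite mu0 ?notN// (zT z).2; first by lia.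
    by apply: NZ; right.
  have d_eq1 : d = 1.
    have [_ tA tB tC] := psi_translation p q r.
    move: tA tB tC; rewrite -dE !dABC// => p0 q0 r0; rewrite dE -p0 -q0 -r0.
    by rewrite /Delta_translation /HW_translation !zexp0 !mulg1.
  have v1 : v = 1.
    apply/rowP => j; rewrite mxE; have := cE (iota j).
    rewrite (zT z).2; last by apply: NZ; left.
    by rewrite mu_iota d_eq1 (morph_1 psiM) coord1 add0r addr0.
  move: zvd; rewrite d_eq1 v1 (morph_1 psiM) (morph_1 muM) !mulg1 => z1.
  by congr (_, _); apply: val_inj.
(* Factors are peeled off: [d0] matches the class of [g], [d1] the coordinates along [A], [B], [C],
   and [v] the remaining noncentral ones; what is left is central. *)
move=> g; have [d0 d0k] := psi_lattice_surj g.
have t0 : kap (g * (psi d0)^-1) = 1 by rewrite kapM kapV d0k mulgV.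
set t := g * (psi d0)^-1 in t0.
pose d1 := Delta_translation (coord t A) (coord t B) (coord t C).
have [s0 sA sB sC] := psi_translation (coord t A) (coord t B) (coord t C).
rewrite -/(Delta_translation _ _ _) -/d1 in s0 sA sB sC.
have sV : kap (psi d1)^-1 = 1 by rewrite kapV s0 invg1.
pose u := t * (psi d1)^-1; have u1 : kap u = 1 by rewrite kapM t0 sV mulg1.
have uE i : coord u i = (coord t i - coord (psi d1) i)%R.
  by rewrite coordM// coordV.
have uABC i : i \in [set A; B; C] -> coord u i = 0%R.
  by rewrite uE !inE -orbA => /or3P[] /eqP ->; rewrite ?sA ?sB ?sC subrr.
pose v : Zpow m := (\row_j coord u (iota j))%R.
pose z := u * (mu v)^-1.
have muV1 : kap (mu v)^-1 = 1 by rewrite kapV mu1 invg1.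
have zcen : z \in group_center G.
  apply/center_lattice; split=> [|i iNZ]; first by rewrite kapM u1 muV1 mulg1.
  rewrite coordM// coordV//.
  have [/iota_surj[j ->]|iN] := boolP (i \in noncyclic_types).
    by rewrite mu_iota mxE subrr.
  rewrite mu0// subr0; apply: uABC; move: iN; rewrite inE negbK inE.
  by case/orP => //; rewrite inE => /asboolP.
exists (Sub z zcen, (v, d1 * d0)); rewrite /F /= psiM.
by rewrite /z /u /t !mulgA !mulgVK.
Qed.

End HantzscheWendtSplitting.

Theorem diagonal_extension_dichotomy (G : groupType) (n k : nat) :
  diagonal_extension G n -> torsion_free G -> first_betti_number G k ->
  poly_Z G \/
  ((k + 3 <= n)%N /\
   exists phi : group_action Delta_P (Zpow (n - k - 3)),
     isomorphic G (subgroup_type (group_center G) * semidirect phi)%type).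
Proof.
move=> D Gtf [kex kmax].
have [Tex Tmax] := betti_central_types D.
have -> : k = #|central_types D|.
  by apply/eqP; rewrite eqn_leq; case: kex => v /Tmax ->; case: Tex => w /kmax ->.
have [[i iZ [g [a ga]]]|noodd] := pselect (exists2 i, central_type D i &
    exists g (a : int), tau D g i = (2 * a + 1)%R).
  by left; exact: (poly_Z_central Gtf iZ ga).
right.
have even i : central_type D i -> forall g, exists a : int, tau D g i = (2 * a)%R.
  move=> iZ g; exists (divz (tau D g i) 2).
  have E := divz_eq (tau D g i) 2; have := @modz_ge0 (tau D g i) 2 isT.
  have := @ltz_mod (tau D g i) 2 isT; move: E.
  set r := modz _ _; set q := divz _ _ => E r2 r0.
  suff : r <> 1%R by lia.
  by move=> r1; apply: noodd; exists i => //; exists g, q; rewrite E r1; lia.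
have [x [y [A [B [C gen]]]]] := HW_generators_exist Gtf even.
have [psi [psiM psix psiy]] := HW_hom_exists gen.
have [kn mE] := central_types_size gen.
by split=> //; exact: (center_semidirect_splitting gen psiM psix psiy mE).
Qed.

(** * Lattices of crystallographic groups *)

Section DiscreteIndependent.
Local Open Scope ring_scope.
Variables (R : realType) (n m : nat) (F : 'M[R]_(n, m)) (e : R).

(** Simultaneous approximation: two multiples [N *: u], [N' *: u] with close
    fractional parts give a nonzero integer vector with small image. *)
Lemma discrete_independent : 0 < e ->
  (forall a : 'cV[int]_m, a != 0 ->
     exists i, e <= `|(F *m map_mx intr a) i 0|) ->
  forall v : 'cV[R]_m, F *m v = 0 -> v = 0.
Proof.
move=> e0 sep v Fv; apply/eqP; apply: contraT => v0.
have [j0 vj0] : exists j, v j 0 != 0.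
  apply: contrapT => v'; case/eqP: v0; apply/colP => j; rewrite mxE.
  by apply/eqP; apply: contrapT => /negP vj; apply: v'; exists j.
(* With entry 1 at [j0], the floors there are [N] and [N'] themselves, so the integer vector [a]
   below is nonzero. *)
have [u Fu uj0] : exists2 u : 'cV[R]_m, F *m u = 0 & u j0 0 = 1.
  by exists ((v j0 0)^-1 *: v); rewrite ?mxE ?mulVf// -scalemxAr Fv scaler0.
pose C : R := \sum_i \sum_j `|F i j|.
have C0 : 0 <= C by rewrite /C sumr_ge0// => i _; rewrite sumr_ge0.
(* Fractional parts in one cell of width [1/K] move the image by at most [C/K], which is below
   [e]. *)
pose K := (Num.truncn (C / e)).+1.
have CK : C < e * K%:R by rewrite mulrC -ltr_pdivrMr// truncnS_gt.
have K0 : 0 < K%:R :> R by rewrite ltr0n.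
pose fr (N : nat) j : R := N%:R * u j 0 - (Num.floor (N%:R * u j 0))%:~R.
have fr0 N j : 0 <= fr N j by rewrite subr_ge0 floor_le.
have fr1 N j : fr N j < 1.
  by rewrite ltrBlDr addrC; have := floorD1_gt (N%:R * u j 0); rewrite intrD.
have cellP N j : (Num.truncn (fr N j * K%:R) < K)%N.
  rewrite -(ltr_nat R); apply: (@le_lt_trans _ _ (fr N j * K%:R)).
    by have /andP[] := truncn_itv (mulr_ge0 (fr0 N j) (ltW K0)).
  by rewrite gtr_pMl.
(* Pigeonhole: [K ^ m + 1] multiples of [u] fall into [K ^ m] cells. *)
pose cell (N : 'I_(K ^ m).+1) : {ffun 'I_m -> 'I_K} := [ffun j => Ordinal (cellP N j)].
have [N [N' [NN' cellE]]] : exists N N', N != N' /\ cell N = cell N'.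
  apply: contrapT => noNN'.
  have : injective cell.
    move=> N N' cNN'; apply/eqP; apply: contrapT => /negP NN'.
    by apply: noNN'; exists N, N'.
  move=> /leq_card; rewrite card_ord card_ffun !card_ord; lia.
pose a : 'cV[int]_m :=
  \col_j (Num.floor ((N : nat)%:R * u j 0) - Num.floor ((N' : nat)%:R * u j 0)).
have aE : map_mx intr a = ((N : nat)%:R - (N' : nat)%:R) *: u +
    \col_j (fr N' j - fr N j).
  by apply/colP => j; rewrite !mxE intrB /fr; ring.
have a0 : a != 0.
  apply/eqP => /colP/(_ j0); rewrite !mxE uj0 !mulr1 !pmulrn !intrKfloor => /eqP.
  by rewrite subr_eq0 eqz_nat (inj_eq val_inj) (negbTE NN').
have [i] := sep a a0; rewrite aE mulmxDr -scalemxAr Fu scaler0 add0r leNgt => /negP[].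
rewrite mxE; apply: (@le_lt_trans _ _ (C / K%:R)); last by rewrite ltr_pdivrMr.
apply: (le_trans (ler_norm_sum _ _ _)).
apply: (@le_trans _ _ ((\sum_j `|F i j|) / K%:R)); last first.
  rewrite ler_pM2r ?invr_gt0// /C (bigD1 i)//= lerDl.
  by rewrite sumr_ge0// => l _; rewrite sumr_ge0.
rewrite mulr_suml; apply: ler_sum => j _; rewrite normrM ler_wpM2l// mxE.
have cj : Num.truncn (fr N j * K%:R) = Num.truncn (fr N' j * K%:R).
  by have /ffunP/(_ j) := cellE; rewrite !ffunE => -[].
have /andP[l1 u1] := truncn_itv (mulr_ge0 (fr0 N j) (ltW K0)).
have /andP[] := truncn_itv (mulr_ge0 (fr0 N' j) (ltW K0)).
rewrite -cj -natr1 => l2 u2; rewrite -natr1 in u1.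
rewrite -[X in X <= _](mulfK (lt0r_neq0 K0)) -[X in _ <= X]mul1r ler_pM2r ?invr_gt0//.
rewrite -[X in _ * X](ger0_norm (ltW K0)) -normrM ler_norml mulrBl.
by apply/andP; split; lra.
Qed.

End DiscreteIndependent.

(** * Consequences of discreteness and cocompactness for the translations *)

Section Geometry.
Local Open Scope classical_set_scope.
Local Open Scope ring_scope.
Variables (R : realType) (n : nat).

Definition trans (g : Isom R n) : 'cV[R]_n := g.1.
Definition linpart (g : Isom R n) : 'M[R]_n := val g.2.

Lemma transM (g h : Isom R n) : trans (g * h)%g = trans g + linpart g *m trans h.
Proof. by []. Qed.

Lemma linpartM (g h : Isom R n) : linpart (g * h)%g = linpart g *m linpart h.
Proof. by []. Qed.

Lemma trans_inv (g : Isom R n) : trans g^-1%g = (linpart g)^T *m - trans g.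
Proof. by []. Qed.

Lemma trans1 : trans 1%g = 0. Proof. by []. Qed.

Lemma linpart1 : linpart 1%g = 1%:M. Proof. by []. Qed.

Lemma Isom_eq (g h : Isom R n) : trans g = trans h -> linpart g = linpart h -> g = h.
Proof.
case: g h => [v A] [w B]; rewrite /trans /linpart /= => -> AB.
by congr pair; exact: val_inj.
Qed.

Lemma linpart_eq1 (g : Isom R n) : g.2 = 1%g <-> linpart g = 1%:M.
Proof. by split=> [|g1]; [rewrite /linpart => ->|exact: val_inj]. Qed.

Lemma trans_conj (g t : Isom R n) : linpart t = 1%:M ->
  trans (g * t * g^-1)%g = linpart g *m trans t /\ linpart (g * t * g^-1)%g = 1%:M.
Proof.
move=> t1; rewrite !transM !linpartM t1 mulmx1 trans_inv mulmxA.
have gV : linpart g *m (linpart g)^T = 1%:M by exact: (mulmx1C (Defs.orthogonalP g.2)).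
have -> : linpart g^-1%g = (linpart g)^T by [].
by rewrite gV mul1mx addrAC addrN add0r.
Qed.

(** Isolation of the identity, pulled back along the continuous map [w] sending a vector to its
    translation, gives a ball for the maximum norm without nonzero lattice vectors. *)
Lemma lattice_discrete (Gamma : groupClosed (Isom R n)) :
  discrete_subgroup Gamma -> exists2 e : R, 0 < e &
    forall t, t \in Gamma -> linpart t = 1%:M -> t <> 1%g ->
      exists i, e <= `|trans t i 0|.
Proof.
move=> /(_ _ gpred1)[_ [V V1 VE]].
pose w (v : 'cV[R]_n) : Isom R n := (v, 1%g).
have w_cont : continuous (w : 'cV[R]_n -> initial_topology (@isometry_coord R n)).
  apply: continuous_comp_initial => v.
  rewrite (_ : _ \o w = fun v : 'cV[R]_n => (v, 1%:M : 'M[R]_n))//.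
  exact: (@cvg_pair _ _ _ (nbhs v) (nbhs v) (nbhs (1%:M : 'M[R]_n)) (nbhs_filter v)
    (nbhs_filter v) (nbhs_filter _) id (fun=> 1%:M) cvg_id (cvg_cst _)).
have : nbhs (0 : 'cV[R]_n) (w @^-1` V) by exact: (w_cont 0 V V1).
move=> /nbhs_ballP[e e0 eV]; exists e => // t tG t1 tN1; apply: contrapT => small.
apply: tN1; have : [set 1%g] t; last by [].
rewrite -VE; split; last exact: tG.
have -> : t = w (trans t) by apply: Isom_eq.
apply: eV; split=> // i j; rewrite /ball/= ord1 mxE sub0r normrN.
by rewrite ltNge; apply/negP => te; apply: small; exists i.
Qed.

(** In the coordinates [p] of an isometry [h], this is [g *m trans h^-1], a polynomial in the
    entries. *)
Lemma affine_form_continuous (g : 'rV[R]_n) : continuous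
  (fun p : 'cV[R]_n * 'M[R]_n => (g *m (p.2^T *m - p.1)) 0 0).
Proof.
pose h (p : 'cV[R]_n * 'M[R]_n) := \sum_(j < n) \sum_(i < n)
  g 0 j * (p.2 i j * - p.1 i 0).
rewrite (_ : (fun _ => _) = h); last first.
  apply/funext => p; rewrite mxE; apply: eq_bigr => j _.
  by rewrite mxE mulr_sumr; apply: eq_bigr => i _; rewrite !mxE.
apply: continuous_big => [|j _]; first exact: add_continuous.
apply: continuous_big => [|i _]; first exact: add_continuous.
move=> p; apply: cvgM; first exact: cvg_cst.
apply: cvgM.
  apply: (@continuous_comp _ _ _ snd (fun M : 'M[R]_n => M i j) p).
    exact: cvg_snd.
  exact: coord_continuous.
apply: cvgN.
apply: (@continuous_comp _ _ _ fst (fun v : 'cV[R]_n => v i 0) p).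
  exact: cvg_fst.
exact: coord_continuous.
Qed.

(** [h |-> \sum_a (f (gamma_a h^-1 0))^2], with [gamma_a] representing the
    cosets of the lattice, is a continuous function on the compact coset space;
    it is unbounded unless [f] vanishes. *)
Lemma lattice_spans (Gamma : groupClosed (Isom R n))
    (k : subgroup_type Gamma -> ('Z_2 * 'Z_2)%type) :
  cocompact_subgroup Gamma -> {morph k : x y / (x * y)%g} ->
  (forall z, exists g, k g = z) ->
  (forall g, k g = 1%g <-> linpart (val g) = 1%:M) ->
  forall f : 'rV[R]_n, (forall t, k t = 1%g -> f *m trans (val t) = 0) -> f = 0.
Proof.
move=> coG kM /choice[gam gamK] k1 f fL.
pose term a (h : Isom R n) := (f *m trans (val (gam a) * h^-1)%g) 0 0.
pose F (h : Isom R n) := \sum_a term a h ^+ 2.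
have termL t g (h : Isom R n) : k t = 1%g ->
    f *m trans (val t * g * h)%g = f *m trans (g * h)%g.
  move=> t1; have tl := (k1 t).1 t1.
  by rewrite -mulgA transM mulmxDr fL// add0r tl mul1mx.
have F_inv (h h' : Isom R n) : (h^-1 * h')%g \in Gamma -> F h = F h'.
  move=> hh'; pose s : subgroup_type Gamma := exist _ (h^-1 * h')%g hh'.
  (* Multiplication by the class of [s] permutes the lattice cosets; each term then changes by a
     translation of [Gamma], which [f] annihilates. *)
  rewrite /F (reindex_inj (mulIg (k s)^-1%g)) /=; apply: eq_bigr => a _.
  congr (_ ^+ 2); rewrite /term.
  pose t := (gam (a * (k s)^-1)%g * s * (gam a)^-1)%g.
  have t1 : k t = 1%g by rewrite /t !kM (morph_V kM) !gamK mulgVK mulgV.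
  rewrite -(termL t (val (gam a)) h'^-1%g t1).
  have -> : (val t * val (gam a) * h'^-1)%g = (val (gam (a * (k s)^-1)%g) * h^-1)%g => //.
  have -> : val t = (val (gam (a * (k s)^-1)%g) * (h^-1 * h') * (val (gam a))^-1)%g by [].
  by rewrite !mulgA mulgVK mulgK.
have F_cont : continuous F.
  pose T' a (p : 'cV[R]_n * 'M[R]_n) : R := (f *m trans (val (gam a))) 0 0 +
    (f *m linpart (val (gam a)) *m (p.2^T *m - p.1)) 0 0.
  pose F' (p : 'cV[R]_n * 'M[R]_n) := \sum_a T' a p * T' a p.
  have -> : F = F' \o (@isometry_coord R n).
    apply/funext => h; apply: eq_bigr => a _; rewrite -expr2; congr (_ ^+ 2).
    by rewrite /term transM mulmxDr mxE mulmxA trans_inv.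
  have T'_cont a : continuous (T' a).
    by move=> p; apply: cvgD; [exact: cvg_cst|exact: affine_form_continuous].
  have F'_cont : continuous F'.
    apply: continuous_big => [|a _ p]; first exact: add_continuous.
    by apply: cvgM; exact: T'_cont.
  move=> h; apply: continuous_comp; first exact: initial_continuous.
  exact: F'_cont.
pose Q := quotient_topology (coset_space Gamma).
have GF_cont : continuous (F \o repr : Q -> R).
  apply: repr_comp_continuous => // a b /eqP.
  move=> /(@eqmodP _ (same_lcoset_equiv Gamma)) ab.
  by apply/eqP/F_inv.
have : compact ((F \o repr : Q -> R) @` [set: Q]).
  by apply: continuous_compact => //; exact: continuous_subspaceT.
move=> /(@compact_bounded R R)[M [_ MP]].
have {}MP h : F h <= `|M| + 1.
  have Frepr : F (repr (\pi_(coset_space Gamma) h)%qT) = F h.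
    apply: F_inv; apply/(@eqmodP _ (same_lcoset_equiv Gamma)).
    by rewrite reprK.
  have := MP (`|M| + 1); rewrite (le_lt_trans (ler_norm M)) ?ltrDl// => /(_ isT).
  have Fh0 : 0 <= F h by rewrite /F sumr_ge0// => a _; exact: sqr_ge0.
  move=> /(_ (F h)); rewrite /= (ger0_norm Fh0).
  by apply; exists (\pi_(coset_space Gamma) h)%qT => //=.
apply/eqP; apply: contraT => f0.
pose q := (f *m f^T) 0 0.
have q0 : 0 < q.
  have [j fj] : exists j, f 0 j != 0.
    apply: contrapT => f'; case/eqP: f0; apply/rowP => j; rewrite mxE.
    by apply/eqP; apply: contrapT => /negP fj; apply: f'; exists j.
  rewrite /q mxE (bigD1 j)//= ltr_pwDl//.
    by rewrite mxE -expr2 lt_def sqrf_eq0 fj sqr_ge0.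
  by rewrite sumr_ge0// => i _; rewrite mxE -expr2 sqr_ge0.
(* Scaled so that [f *m w] equals [|M| + 2], whose square exceeds the bound [|M| + 1]. *)
pose w : 'cV[R]_n := ((`|M| + 2) / q) *: f^T.
pose h : Isom R n := ((w, 1%g) : Isom R n)^-1%g.
have := MP h; rewrite leNgt => /negP[].
have term1 : term 1%g h = `|M| + 2.
  rewrite /term /h invgK -[val _]mulg1 termL ?gamK// mul1g.
  rewrite -[trans _]/w -scalemxAr mxE -/q mulfVK//.
  by rewrite gt_eqF.
rewrite /F (bigD1 (1%g : ('Z_2 * 'Z_2)%type))//= term1; apply: ltr_wpDr.
  by rewrite sumr_ge0// => a _; exact: sqr_ge0.
have M0 : 0 <= `|M| by []; nra.
Qed.

End Geometry.

(** The predicate [inL] and the dimension [m] are arbitrary, so that coordinates can be carried from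
    the diagonal model to [Gamma] before the dimensions are compared. *)
Record lattice_coordinates (G : groupType) (inL : G -> Prop) (m : nat)
    (c : G -> 'I_m -> int) (vec : ('I_m -> int) -> G) (s : G -> 'I_m -> int) : Prop :=
  LatticeCoordinates {
    lc_vec : forall a, inL (vec a);
    lc_vecE : forall a i, c (vec a) i = a i;
    lc_add : forall x y, inL x -> inL y -> forall i, c (x * y) i = (c x i + c y i)%R;
    lc_inj : forall x y, inL x -> inL y -> (forall i, c x i = c y i) -> x = y;
    lc_sgn : forall g i, s g i = 1%R \/ s g i = (-1)%R;
    lc_conj : forall g x, inL x -> forall i, c (g * x * g^-1) i = (s g i * c x i)%R;
    lc_faithful : forall g, (forall i, s g i = 1%R) -> inL g
  }.

Definition is_translation (R : realType) (n : nat) (Gamma : groupClosed (Isom R n))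
  (g : subgroup_type Gamma) : Prop := linpart (val g) = 1%:M%R.

(** * Rank and diagonal coordinates of the translation lattice *)

Section Translations.
Variables (R : realType) (n : nat) (Gamma : groupClosed (Isom R n)).
Local Notation G := (subgroup_type Gamma).
Implicit Types g t : G.

Lemma is_translationP g : (g \in lattice Gamma) <-> is_translation g.
Proof.
split=> [/eqP g1|/linpart_eq1 g1]; first exact/linpart_eq1.
exact/eqP.
Qed.

Lemma is_translation1 : is_translation (1 : G).
Proof. exact: linpart1. Qed.

Lemma is_translationM g t : is_translation g -> is_translation t -> is_translation (g * t).
Proof. by rewrite /is_translation => g1 t1; rewrite [LHS]linpartM g1 t1 mulmx1. Qed.

Lemma is_translationJ g t : is_translation t -> is_translation (g * t * g^-1).
Proof. by move=> t1; have [] := trans_conj (val g) t1. Qed.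

Lemma transM_translation g t : is_translation g ->
  (trans (val (g * t)%g) = trans (val g) + trans (val t))%R.
Proof. by move=> g1; rewrite [LHS]transM g1 mul1mx. Qed.

Lemma translation_inj g t : is_translation g -> is_translation t ->
  trans (val g) = trans (val t) -> g = t.
Proof. by move=> g1 t1 gt; apply/val_inj/Isom_eq => //; rewrite g1 t1. Qed.

Lemma integer_matrix (m : nat) (h : 'cV[int]_m -> 'cV[R]_n) :
  {morph h : a b / a + b}%R ->
  forall a, h a = ((\matrix_(i, j) h (delta_mx j 0) i 0) *m map_mx intr a)%R.
Proof.
move=> hD a; have h0 : h 0%R = 0%R by apply: (addrI (h 0%R)); rewrite -hD !addr0.
have hN b : (h (- b) = - h b)%R by apply: (addrI (h b)); rewrite -hD !addrN.
have hZ (b : int) v : h (b *: v)%R = (b%:~R *: h v)%R.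
  elim/int_ind: b => [|b IH|b IH]; first by rewrite !scale0r.
    have -> : (b.+1%:Z = b%:Z + 1)%R by lia.
    by rewrite scalerDl scale1r hD IH intrD scalerDl scale1r.
  have -> : (- b.+1%:Z = - b%:Z - 1)%R by lia.
  by rewrite scalerBl scale1r hD IH hN intrB scalerBl scale1r.
rewrite {1}[a]matrix_sum_delta (big_morph h hD h0).
under eq_bigr => i _ do rewrite big_ord1 hZ.
apply/colP => i; rewrite summxE mxE; apply: eq_bigr => j _.
by rewrite !mxE mulrC.
Qed.

(** Discreteness makes the generators independent over the reals, so [m <= n]; no nonzero linear
    form vanishes on them, so [n <= m]. *)
Lemma lattice_rank (m : nat) c vec s :
  discrete_subgroup Gamma ->
  @lattice_coordinates G (@is_translation _ _ Gamma) m c vec s ->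
  (forall f : 'rV[R]_n,
     (forall t : G, is_translation t -> f *m trans (val t) = 0)%R -> f = 0%R) ->
  m = n.
Proof.
move=> /lattice_discrete[e e0 sep] lc spans.
pose h (a : 'cV[int]_m) := trans (val (vec (fun j => a j 0%R))).
have hD : {morph h : a b / a + b}%R.
  move=> a b; have [va vb] := (lc_vec lc (a^~ 0%R), lc_vec lc (b^~ 0%R)).
  rewrite /h -(transM_translation _ va); congr (trans (val _)).
  apply: (lc_inj lc) => [||i]; [exact: lc_vec lc _|exact: is_translationM|].
  by rewrite (lc_add lc)// !(lc_vecE lc) mxE.
have c1 i : c 1 i = 0%R.
  have E := lc_add lc is_translation1 is_translation1 i; rewrite mulg1 in E.
  by apply: (addrI (c 1 i)); rewrite -E addr0.
pose F : 'M[R]_(n, m) := (\matrix_(i, j) h (delta_mx j 0) i 0)%R.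
have hE a : h a = (F *m map_mx intr a)%R by exact: integer_matrix.
have F_inj := @discrete_independent R n m F e e0.
apply/eqP; rewrite eqn_leq; apply/andP; split.
  suff /eqP <- : row_free F^T by rewrite rank_leq_col.
  apply: inj_row_free => v vF; apply: trmx_inj; rewrite trmx0; apply: F_inj.
    move=> a a0; have /negP aN1 : vec (fun j => a j 0%R) != 1.
      apply: contra a0 => /eqP a1; apply/eqP/colP => j.
      by rewrite mxE -(lc_vecE lc (fun j => a j 0%R)) a1 c1.
    have [|||i ei] := sep (val (vec (fun j => a j 0%R))).
    - exact: valP.
    - exact: lc_vec lc _.
    - by move=> a1; apply: aN1; apply/eqP/val_inj.
    by exists i; rewrite -hE.
  by rewrite -[F]trmxK -trmx_mul vF trmx0.
suff /eqP <- : row_free F by rewrite rank_leq_col.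
apply: inj_row_free => f fF; apply: spans => t t1.
have -> : trans (val t) = h (\col_j c t j)%R.
  congr (trans (val _)); apply: (lc_inj lc) => //; first exact: lc_vec lc _.
  by move=> i; rewrite (lc_vecE lc) mxE.
by rewrite hE mulmxA fF mul0mx.
Qed.

(** Coordinates come from the given basis, signs from the holonomy representation. If all signs of
    [g] are [+1], its linear part fixes the columns of [E]; these are independent, so the square
    matrix [E] is invertible and [g] is a translation. *)
Lemma diagonal_lattice_coordinates :
  discrete_subgroup Gamma -> diagonal_holonomy Gamma ->
  exists c vec s, @lattice_coordinates G (@is_translation _ _ Gamma) n c vec s.
Proof.
move=> /lattice_discrete[eps eps0 sep] [e [e_basis e_diag]].
have inL (x : subgroup_type (lattice Gamma)) : is_translation (val x).
  by apply/is_translationP; exact: (valP x).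
pose P (x : subgroup_type (lattice Gamma)) := trans (val (val x)).
have PM x y : P (x * y) = (P x + P y)%R by exact: transM_translation.
pose E : 'M[R]_n := (\matrix_(i, j) P (e j) i 0)%R.
pose el (a : 'I_n -> int) := \prod_(i < n) zexp (e i) (a i).
have PE a : P (el a) = (E *m map_mx intr (\col_j a j))%R.
  rewrite (zexp_additive e a PM); apply/colP => i; rewrite summxE mxE.
  by apply: eq_bigr => j _; rewrite -scaler_int !mxE mulrC.
have el_onto x : exists a, x = el a.
  by have [a [xa _]] := e_basis x; exists a.
have el_inj (a b : 'I_n -> int) : el a = el b -> forall i, a i = b i.
  move=> ab i; have [d [_ d_uniq]] := e_basis (el a).
  have -> : a i = [ffun j => a j] i by rewrite ffunE.
  have -> : b i = [ffun j => b j] i by rewrite ffunE.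
  rewrite -(d_uniq [ffun j => a j]); last by apply: eq_bigr => j _; rewrite ffunE.
  by rewrite -(d_uniq [ffun j => b j])// ab; apply: eq_bigr => j _; rewrite ffunE.
have el0 : el (fun=> 0%R) = 1 by rewrite /el big1.
have E_inj (v : 'cV[R]_n) : (E *m v = 0)%R -> v = 0%R.
  apply: (discrete_independent eps0) => a a0.
  have [|||i ei] := sep (val (val (el (fun j => a j 0%R)))).
  - exact: valP.
  - exact: inL.
  - move=> el1; have : el (fun j => a j 0%R) = 1 by apply/val_inj/val_inj.
    rewrite -el0 => /el_inj a0'.
    by case/eqP: a0; apply/colP => j; rewrite a0' mxE.
  exists i; rewrite (_ : a = \col_j a j 0)%R -?PE//.
  by apply/colP => j; rewrite mxE.
have E_int (a b : 'cV[int]_n) : (E *m map_mx intr a = E *m map_mx intr b)%R -> a = b.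
  move=> ab; have /colP ab0 : (map_mx intr a - map_mx intr b = 0 :> 'cV[R]_n)%R.
    by apply: E_inj; rewrite mulmxBr ab subrr.
  apply/colP => j; apply/eqP; rewrite -(eqr_int R) -subr_eq0.
  by have := ab0 j; rewrite !mxE => ->.
have /choice[c cP] (g : G) : exists a : 'cV[int]_n,
    is_translation g -> trans (val g) = (E *m map_mx intr a)%R.
  (* Outside the lattice the coordinates get the default value 0. *)
  have [g1|gN1] := pselect (is_translation g); last by exists 0%R.
  have [a ga] := el_onto (Sub g (iffRL (is_translationP g) g1)).
  by exists (\col_j a j)%R => _; rewrite -PE -ga.
have /choice[s sP] (g : G) : exists s : 'I_n -> int, forall i,
    (s i = 1%R \/ s i = (-1)%R) /\ (linpart (val g) *m P (e i) = (s i)%:~R *: P (e i))%R.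
  suff sP i : exists b : int, (b = 1%R \/ b = (-1)%R) /\
      (linpart (val g) *m P (e i) = b%:~R *: P (e i))%R.
    by have /choice[s sP'] := sP; exists s.
  have gconj : val (holonomy_rep (\pi_(quotient_group (lattice Gamma)) g)%qT (e i)) =
      g * val (e i) * g^-1.
    by rewrite holonomy_repE /conjg invgK mulgA.
  have [gl _] := trans_conj (val g) (inL (e i)).
  have {}gl : (linpart (val g) *m P (e i))%R =
      P (holonomy_rep (\pi_(quotient_group (lattice Gamma)) g)%qT (e i)).
    by rewrite /P gconj -gl.
  case: (e_diag (\pi_(quotient_group (lattice Gamma)) g)%qT i) => ei.
    by exists 1%R; split; [left|rewrite gl ei scale1r].
  exists (-1)%R; split; [by right|rewrite gl ei].
  rewrite scaleN1r; apply: (addrI (P (e i))); rewrite -PM mulgV addrN.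
  exact: trans1.
have gE (g : G) (a : 'cV[int]_n) : (linpart (val g) *m (E *m map_mx intr a) =
    E *m map_mx intr (\col_j (s g j * a j 0)))%R.
  have EE b : (E *m map_mx intr b = \sum_j (b j 0)%:~R *: P (e j))%R.
    by apply/colP => i; rewrite summxE mxE; apply: eq_bigr => j _; rewrite !mxE mulrC.
  rewrite !EE mulmx_sumr; apply: eq_bigr => j _.
  by rewrite -scalemxAr (sP g j).2 scalerA mxE intrM mulrC.
have cE (g : G) (a : 'cV[int]_n) : is_translation g ->
    trans (val g) = (E *m map_mx intr a)%R -> forall i, c g i 0%R = a i 0%R.
  by move=> g1 ga i; suff -> : c g = a by []; apply: E_int; rewrite -ga -cP.
exists (fun g i => c g i 0%R), (fun a => val (el a)), s; split.
- by move=> a; exact: inL.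
- by move=> a i; rewrite (cE _ (\col_j a j)%R) ?mxE//; exact: PE.
- move=> x y x1 y1 i; rewrite (cE _ (c x + c y)%R) ?mxE//.
    exact: is_translationM.
  by rewrite transM_translation// !cP// map_mxD mulmxDr.
- move=> x y x1 y1 xy; apply: translation_inj => //; rewrite !cP//.
  by congr (_ *m map_mx _ _)%R; apply/colP.
- by move=> g i; have [] := sP g i.
- move=> g x x1 i; rewrite (cE _ (\col_j (s g j * c x j 0))%R) ?mxE//.
    exact: is_translationJ.
  by rewrite -gE -cP//; have [->] := trans_conj (val g) x1.
move=> g s1; have Eu : E \in unitmx.
  rewrite -unitmx_tr -row_free_unit; apply: inj_row_free => v vE.
  apply: trmx_inj; rewrite trmx0; apply: E_inj.
  by rewrite -[E]trmxK -trmx_mul vE trmx0.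
have gEE : (linpart (val g) *m E = E)%R.
  apply/row_matrixP => i; apply/rowP => j; rewrite !mxE.
  have [_ /colP/(_ i)] := sP g j; rewrite s1 scale1r => gi.
  by rewrite -[RHS]gi mxE; apply: eq_bigr => l _; rewrite mxE.
by rewrite /is_translation -[linpart _](mulmxK Eu) gEE mulmxV.
Qed.

End Translations.

(** * Comparison of a Bieberbach group with its diagonal model *)

Theorem corollary1p7 (R : realType) (n : nat) (Gamma : groupClosed (Isom R n))
    (k : nat) :
  bieberbach Gamma ->
  diagonal_type Gamma ->
  isomorphic (holonomy Gamma) ('Z_2 * 'Z_2)%type ->
  first_betti_number (subgroup_type Gamma) k ->
  poly_Z (subgroup_type Gamma) \/
  ((k + 3 <= n)%N /\
   exists phi : group_action Delta_P (Zpow (n - k - 3)),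
     isomorphic (subgroup_type Gamma)
       (subgroup_type (group_center (subgroup_type Gamma)) * semidirect phi)%type).
Proof.
move=> [[disc coc] tf] [m [Gamma' [[disc' _] diag [theta theta_bij]]]] [iso iso_bij] bettik.
case: (theta_bij) => eta thetaK etaK; have thetaM := @gmulfM _ _ theta.
have etaM := can2_gmulfM thetaK etaK.
have [c [vec [s lc]]] := diagonal_lattice_coordinates disc' diag.
pose pi (g : subgroup_type Gamma) : holonomy Gamma :=
  (\pi_(quotient_group (lattice Gamma)) g)%qT.
have piM : {morph pi : x y / x * y} by move=> x y; apply/esym; exact: quotient_mulE.
pose kap g := iso (pi g).
have kapM : {morph kap : x y / x * y} by move=> x y; rewrite /kap piM gmulfM.
have kap_surj z : exists g, kap g = z.
  case: iso_bij => j isoK jK; exists (repr (j z : quotient_group (lattice Gamma))).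
  by rewrite /kap /pi reprK jK.
have kap1 g : kap g = 1 <-> is_translation g.
  have := @eq_quotient_group _ (lattice Gamma) 1 g; rewrite invg1 mul1g => piE.
  split=> [g1|/is_translationP/piE pi1g].
    apply/is_translationP/piE; apply: (bij_inj iso_bij).
    by rewrite -/(kap g) g1; exact: (morph_1 kapM).
  by rewrite /kap /pi -pi1g; exact: (morph_1 kapM).
have spans := lattice_spans coc kapM kap_surj kap1.
(* The square of any [eta t] is a translation of [Gamma], so it commutes with [x]. *)
have kapL x : kap x = 1 -> is_translation (theta x).
  move=> x1; apply: (lc_faithful lc) => i.
  pose t := vec (fun=> 1%R); have t1 : is_translation t := lc_vec lc _.
  have tt1 : is_translation (t * t) by exact: is_translationM.
  have etat : kap (eta t * eta t) = 1 by rewrite kapM klein_sqr.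
  have xt : commute x (eta t * eta t).
    have [x1' u1] := ((kap1 x).1 x1, (kap1 _).1 etat).
    apply: translation_inj; [exact: is_translationM..|].
    by rewrite (transM_translation _ x1') (transM_translation _ u1) addrC.
  have thxt : theta x * (t * t) * (theta x)^-1 = t * t.
    by have := congr1 theta xt; rewrite !thetaM !etaK => ->; rewrite mulgK.
  (* All coordinates of [t * t] are 2 and conjugation by [theta x] fixes them, which excludes the
     sign [-1]. *)
  have := lc_conj lc (theta x) tt1 i; rewrite thxt (lc_add lc)// (lc_vecE lc).
  by case: (lc_sgn lc (theta x) i) => ->; lia.
(* The images of translations of [Gamma] are translations by [kapL], so [theta x] commutes with
   them; hence the linear part of [x] fixes a spanning set. *)
have kapL' x : is_translation (theta x) -> kap x = 1.
  move=> x1; apply/kap1/eqP; rewrite -subr_eq0; apply/eqP/row_matrixP => i.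
  rewrite row0; apply: spans => t t1; rewrite -row_mul mulmxBl mul1mx.
  suff -> : (linpart (val x) *m trans (val t) = trans (val t))%R by rewrite subrr row0.
  have [<- _] := trans_conj (val x) ((kap1 t).1 t1).
  suff tx : x * t = t * x.
    congr trans; apply: (mulIg (val x)); rewrite mulgVK.
    exact: (congr1 (fun g : subgroup_type Gamma => val g) tx).
  apply: (can_inj thetaK); rewrite !thetaM; have tht := kapL t t1.
  apply: translation_inj; [exact: is_translationM..|].
  by rewrite (transM_translation _ x1) (transM_translation _ tht) addrC.
have kapE x : kap x = 1 <-> is_translation (theta x) by split; [exact: kapL|exact: kapL'].
have lcG : lattice_coordinates (@is_translation _ _ Gamma) (fun g => c (theta g))
    (fun a => eta (vec a)) (fun g => s (theta g)).
  have trE x : is_translation x <-> is_translation (theta x) by rewrite -kap1 kapE.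
  split=> [a|a i|x y /trE x1 /trE y1 i|x y /trE x1 /trE y1 xy|g i|g x /trE x1 i|g g1].
  - by apply/trE; rewrite etaK; exact: lc_vec lc _.
  - by rewrite etaK (lc_vecE lc).
  - by rewrite thetaM (lc_add lc).
  - exact/(can_inj thetaK)/(lc_inj lc).
  - exact: (lc_sgn lc).
  - by rewrite !thetaM (morph_V thetaM) (lc_conj lc).
  by apply/trE/(lc_faithful lc).
have mn : m = n.
  apply: (lattice_rank disc lcG) => f fL; apply: spans => t t1.
  exact/fL/kap1.
subst m; apply: diagonal_extension_dichotomy => //.
apply: (@DiagonalExtension _ _ kap (fun g => c (theta g)) (fun a => eta (vec a))
  (fun g => s (theta g)) kapM kap_surj).
- by move=> x y /kap1 x1 /kap1 y1; exact: (lc_add lcG).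
- by move=> x y /kap1 x1 /kap1 y1; exact: (lc_inj lcG).
- by move=> a; apply/kap1; exact: (lc_vec lcG).
- exact: (lc_vecE lcG).
- exact: (lc_sgn lcG).
- by move=> g x /kap1 x1; exact: (lc_conj lcG).
by move=> g g1; apply/kap1; exact: (lc_faithful lcG).
Qed.
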